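(* Let $\lambda$ be a frequency satisfying (NC) and let $(G,\beta)$ be a $\lambda$-Dirichlet group. For every $\delta>0$ there exists $C>0$ such that, for all $N\in\mathbb N$, all (finite) $p\ge1$ and all $f\in H_p^\lambda(G)$, $$\left(\int_G\sup_{n\le N}|S_nf(\omega)|^p\,d\omega\right)^{1/p}\le Ce^{\delta\lambda_N}\|f\|_p .$$
   Context: A frequency is a (strictly) increasing sequence $\lambda=(\lambda_n)_{n\ge1}$ of nonnegative real numbers tending to $+\infty$. Condition (NC): for every $\delta>0$ there exists $C>0$ such that for every $n\ge1$ there exists $m>n$ with $$\log\left(\frac{\lambda_m+\lambda_n}{\lambda_m-\lambda_n}\right)+(m-n)\le Ce^{\delta\lambda_n}.$$ Let $G$ be a compact abelian group (with normalized Haar measure $d\omega$ and dual group $\widehat G$) and $\beta:(\mathbb R,+)\to G$ a continuous homomorphism with dense range. $(G,\beta)$ is a $\lambda$-Dirichlet group if for every $n$ there exists $h_{\lambda_n}\in\widehat G$ (necessarily unique) with $h_{\lambda_n}(\beta(t))=e^{-i\lambda_n t}$ for all $t\in\mathbb R$. For $p\in[1,+\infty]$, $H_p^\lambda(G)$ is the subspace of $L_p(G)$ of functions $f$ whose Fourier transform $\widehat f$ is supported in $\{h_{\lambda_n}:n\in\mathbb N\}$; $\|\cdot\|_p$ is the $L_p(G)$-norm. The partial sum operator is $S_nf=\sum_{k=1}^n\widehat f(h_{\lambda_k})h_{\lambda_k}$. *)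

(* Defs.v *)
From HB Require Import structures.
From mathcomp Require Import all_boot all_order all_algebra.
From mathcomp Require Import complex.
From mathcomp Require Import all_classical all_reals all_analysis.

Set Implicit Arguments.
Unset Strict Implicit.
Unset Printing Implicit Defensive.

Import Order.TTheory GRing.Theory Num.Theory.
Import numFieldNormedType.Exports.
Import ComplexField.Normc.

Local Open Scope classical_set_scope.
Local Open Scope ring_scope.
Local Open Scope complex_scope.

(* Sequences indexed by n >= 1 on paper are indexed here from 0, so that
   [lambda n] stands for the (n+1)-st frequency.  All the notions below, up to
   and including the maximal inequality, only use index differences or index
   ranges starting at the first index, hence are invariant under this shift. *)

Definition frequency (R : realType) (lambda : R^nat) : Prop :=
  [/\ forall n, 0 <= lambda n,
      forall m n, (m < n)%N -> lambda m < lambda n &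
      lambda n @[n --> \oo] --> +oo].

Definition condition_NC (R : realType) (lambda : R^nat) : Prop :=
  forall delta : R, 0 < delta ->
  exists2 C : R, 0 < C &
  forall n, exists2 m, (n < m)%N &
    ln ((lambda m + lambda n) / (lambda m - lambda n)) + (m - n)%:R
      <= C * expR (delta * lambda n).

(* G with its Borel sigma-algebra.  This is an alias because a
   [topologicalZmodType] is not pointed, as [g_sigma_algebraType] requires. *)
Definition borel (G : topologicalZmodType) : Type := G.

HB.instance Definition _ (G : topologicalZmodType) := Choice.on (borel G).
HB.instance Definition _ (G : topologicalZmodType) :=
  isPointed.Build (borel G) (0 : G).
HB.instance Definition _ (G : topologicalZmodType) :=
  @isMeasurable.Build (sigma_display (@open G)) (borel G) <<s @open G >>
    (@sigma_algebra0 (borel G) setT (@open G))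
    (@sigma_algebraC (borel G) (@open G))
    (@sigma_algebra_bigcup (borel G) setT (@open G)).

Section haar.
Variables (R : realType) (G : topologicalZmodType).

Definition haar_probability (mu : probability (borel G) R) : Prop :=
  [/\ forall (x : G) (A : set (borel G)), measurable A ->
        mu ((fun y : G => x + y) @` A) = mu A,
      forall A : set (borel G), measurable A ->
        mu A = ereal_inf [set mu U | U in [set U : set G | open U /\ A `<=` U]] &
      forall U : set G, open U ->
        mu U = ereal_sup
          [set mu K | K in [set K : set G | compact K /\ K `<=` U]]].

End haar.

Section dual.
Variables (R : realType) (G : topologicalZmodType).

Definition is_character (chi : G -> R[i]) : Prop :=
  [/\ continuous (chi : G -> (R[i] : numClosedFieldType)),
      forall x y, chi (x + y) = chi x * chi y &
      forall x, normc (chi x) = 1].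

Definition expi (x : R) : R[i] := cos x +i* sin x.

Definition extends_exp (beta : R -> G) (x : R) (h : G -> R[i]) : Prop :=
  is_character h /\ forall t, h (beta t) = expi (- (x * t)).

Definition dirichlet_group (lambda : R^nat) (beta : R -> G) : Prop :=
  [/\ continuous beta,
      forall s t, beta (s + t) = beta s + beta t,
      dense (range beta) &
      forall n, exists h, extends_exp beta (lambda n) h].

(* The character h_x, unique when it exists since beta has dense range; the
   default value [cst 1] is irrelevant under [dirichlet_group]. *)
Definition dirichlet_char (beta : R -> G) (x : R) : G -> R[i] :=
  xget (cst 1) [set h | extends_exp beta x h].

End dual.

Section hardy.
Variables (R : realType) (G : topologicalZmodType).
Variable mu : probability (borel G) R.

Definition cintegral (f : G -> R[i]) : R[i] :=
  Rintegral mu setT (fun w => complex.Re (f w)) +i* Rintegral mu setT (fun w => complex.Im (f w)).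

Definition cLnorm (p : \bar R) (f : G -> R[i]) : \bar R :=
  Lnorm mu p (fun w => (normc (f w))%:E).

Definition Lp (p : \bar R) : set (G -> R[i]) := [set f |
  [/\ measurable_fun setT (fun w : borel G => complex.Re (f w)),
      measurable_fun setT (fun w : borel G => complex.Im (f w)) &
      (cLnorm p f < +oo)%E]].

Definition fourier (f : G -> R[i]) (chi : G -> R[i]) : R[i] :=
  cintegral (fun w => f w * (chi w)^*).

Variables (lambda : R^nat) (beta : R -> G).

Definition Hp (p : \bar R) : set (G -> R[i]) := [set f | Lp p f /\
  forall chi, is_character chi ->
    (forall n, chi <> dirichlet_char beta (lambda n)) -> fourier f chi = 0].

(* The sum of the first n+1 terms, in accordance with the index shift. *)
Definition partial_sum (n : nat) (f : G -> R[i]) (w : G) : R[i] :=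
  \sum_(k < n.+1) fourier f (dirichlet_char beta (lambda k)) *
                  dirichlet_char beta (lambda k) w.

End hardy.

(* Main.v *)
(* Let [T_n] be the trapezoid equal to 1 on [[-lambda_n, lambda_n]] and vanishing
   outside [[-mu_n, mu_n]], where [mu_n = lambda_n + min(1, lambda_m - lambda_n)] and
   [m] is given by (NC).  It is the cosine transform of a kernel [psi_n], and the
   [psi_n] with [n <= N] have a common majorant [Psi] with
   [int Psi <= c ln (a / b)], [a] bounding the frequencies and [b] the gaps; (NC)
   makes this logarithm and the number of frequencies between [lambda_n] and
   [mu_n] at most [C exp (delta lambda_N)].

   To carry this over to [G] without completeness of the characters, let [A] be a
   finite set of frequencies almost invariant under the translations by
   [lambda_0, ..., lambda_N].  The trigonometric polynomial
   [|A|^-1 sum_(x, y in A) T_n (x - y) h_(x - y)], corrected at finitely many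
   frequencies, is a kernel [D_n] whose convolution with [f] is exactly [S_n f],
   since the spectrum of [f] is carried by the [lambda_j].  As [Psi +- psi_n >= 0],
   the functions [V +- T_n] are positive definite, [V] being the transform of [Psi];
   so [|D_n| <= W] for the single trigonometric polynomial [W] built from [V], and
   [sup_n |S_n f| <= |f| * W].  Jensen's inequality then gives the constant [int W]
   for every [p >= 1]. *)
Require Import Defs.
From mathcomp Require Import all_boot all_order all_algebra.
From mathcomp Require Import complex.
From mathcomp Require Import all_classical all_reals all_analysis.
From mathcomp Require Import measurable_realfun.
From mathcomp Require Import ring lra zify.
Import Order.TTheory GRing.Theory Num.Theory.
Import numFieldNormedType.Exports.
Import ComplexField.Normc.
Local Open Scope classical_set_scope.
Local Open Scope ring_scope.
Local Open Scope complex_scope.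

Set Implicit Arguments.
Unset Strict Implicit.
Unset Printing Implicit Defensive.

(** * Kernels on the half-line *)

Section real_integrable.
Context d (T : measurableType d) (R : realType) (mu : {measure set T -> \bar R}).
Variables (D : set T) (mD : measurable D).
Implicit Types f g : T -> R.

Lemma integrable_addR f g : mu.-integrable D (EFin \o f) ->
  mu.-integrable D (EFin \o g) -> mu.-integrable D (EFin \o (fun t => f t + g t)).
Proof. by move=> fi gi; have := integrableD mD fi gi; apply. Qed.

Lemma integrable_subR f g : mu.-integrable D (EFin \o f) ->
  mu.-integrable D (EFin \o g) -> mu.-integrable D (EFin \o (fun t => f t - g t)).
Proof. by move=> fi gi; have := integrableB mD fi gi; apply. Qed.

Lemma integrable_mulRl (k : R) f : mu.-integrable D (EFin \o f) ->
  mu.-integrable D (EFin \o (fun t => k * f t)).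
Proof. by move=> fi; have := integrableZl mD k fi; apply. Qed.

Lemma integrable_mul_bounded f g (M : R) : mu.-integrable D (EFin \o f) ->
  measurable_fun D g -> (forall t, D t -> `|g t| <= M) ->
  mu.-integrable D (EFin \o (fun t => f t * g t)).
Proof.
move=> fi mg gM; have := integrableMl mD fi mg; apply.
exists M; split; first exact: num_real.
by move=> N MN t Dt /=; rewrite (le_trans (gM t Dt))// ltW.
Qed.

End real_integrable.

Section half_line.
Context {R : realType}.
Local Notation leb := (@lebesgue_measure R).
Local Notation D := (`[0%R, +oo[%classic : set R).
Implicit Types (x : R) (f : R -> R).

(** Multiplied by [x], the image of Lebesgue measure under [t |-> x * t] agrees with Lebesgue
    measure on intervals, hence everywhere. *)
Lemma half_line_scaling (f : R -> R) x : 0 < x -> measurable_fun D f ->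
  (forall t, 0 <= t -> 0 <= f t) ->
  (\int[leb]_(t in D) (f (x * t))%:E = x^-1%:E * \int[leb]_(t in D) (f t)%:E)%E.
Proof.
move=> x0 mf f0.
pose phi (t : measurableTypeR R) : measurableTypeR R := x * t.
have mx : measurable_fun setT phi.
  by apply: measurable_funM.
have xi0 : 0 <= x^-1 by rewrite invr_ge0 ltW.
have lebx (A : set R) : measurable A ->
    mscale (NngNum (ltW x0)) (pushforward leb phi) A = leb A.
  move=> mA; apply/esym/lebesgue_measure_unique => //= _ [[a b]] _ <-.
  rewrite /mscale/= /pushforward.
  rewrite (_ : _ @^-1` _ = `]x^-1 * a, x^-1 * b]%classic); last first.
    apply/seteqP; split => t /=; rewrite !in_itv/= ltr_pdivrMl// ler_pdivlMl//.
  rewrite !lebesgue_measure_itv/= !lte_fin ltr_pM2l ?invr_gt0//.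
  case: ifPn => _; last by rewrite mule0.
  by rewrite -EFinB -EFinM; congr EFin; field; rewrite gt_eqF.
have mfD : measurable_fun D (EFin \o f) by apply/measurable_EFinP.
have f0D y : D y -> (0 <= (EFin \o f) y)%E.
  by rewrite /= in_itv/= andbT lee_fin; exact: f0.
rewrite -[x^-1]/(NngNum xi0)%:num -ge0_integral_mscale//.
have DE : D = phi @^-1` D.
  by apply/seteqP; split => t /=; rewrite !in_itv/= !andbT pmulr_rge0.
rewrite [in LHS]DE -[LHS]/(\int[leb]_(t in phi @^-1` D) ((EFin \o f) \o phi) t)%E.
rewrite -(ge0_integral_pushforward mx leb _ mfD)//; last first.
  by move=> y; rewrite inE; exact: f0D.
apply: eq_measure_integral => //= A mA _.
rewrite /mscale/=; have := lebx mx A mA; rewrite /mscale/= => <-.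
by rewrite muleA -EFinM mulVf ?gt_eqF// mul1e.
Qed.

End half_line.

(** * The logarithmic kernel: an explicit majorant of mass [ln (a / b)] *)

Section log_kernel.
Context {R : realType}.
Local Notation leb := (@lebesgue_measure R).
Local Notation D := (`[0%R, +oo[%classic : set R).
Implicit Types (a b t : R).

(** This is [a / (1 + a * t) - b / (1 + b * t)], the derivative of [ln ((1 + a * t) / (1 + b * t))].
    For [b] much smaller than [a] it behaves like [1 / t] between [1 / a] and [1 / b]. *)
Definition log_kernel a b t := (a - b) / ((1 + a * t) * (1 + b * t)).

Lemma log_kernel_ge0 a b t : 0 < b <= a -> 0 <= t -> 0 <= log_kernel a b t.
Proof.
move=> /andP[b0 ba] t0; rewrite divr_ge0 ?subr_ge0// mulr_ge0// addr_ge0//.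
  by rewrite mulr_ge0// (le_trans (ltW b0)).
by rewrite mulr_ge0// ltW.
Qed.

Lemma continuous_log_kernel a b t : 0 < b <= a -> 0 <= t ->
  {for t, continuous (log_kernel a b)}.
Proof.
move=> /andP[b0 ba] t0.
have a0 := lt_le_trans b0 ba.
have at0 : 1 + a * t != 0 by rewrite gt_eqF// ltr_pwDl// mulr_ge0// ltW.
have bt0 : 1 + b * t != 0 by rewrite gt_eqF// ltr_pwDl// mulr_ge0// ltW.
have lin c : {for t, continuous (fun t : R => 1 + c * t)}.
  by apply: cvgD; [exact: cvg_cst|exact: mulrl_continuous].
apply: cvgM; first exact: cvg_cst.
apply: cvgV; first by rewrite mulf_neq0.
by apply: cvgM; exact: lin.
Qed.

Lemma integral_log_kernel a b : 0 < b <= a ->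
  (\int[leb]_(t in D) (log_kernel a b t)%:E = (ln (a / b))%:E)%E.
Proof.
move=> /[dup] ab /andP[b0 ba].
have a0 := lt_le_trans b0 ba.
pose F t := ln (1 + a * t) - ln (1 + b * t).
have pos (c t : R) : 0 < c -> 0 <= t -> 0 < 1 + c * t.
  by move=> c0 t0; rewrite ltr_pwDl// mulr_ge0// ltW.
have dF t : 0 <= t -> is_derive t 1 F (log_kernel a b t).
  move=> t0.
  have dl (c : R) : 0 < c -> is_derive t 1 (fun s : R => ln (1 + c * s)) (c / (1 + c * t)).
    move=> c0.
    have d1 : is_derive t 1 (fun s : R => 1 + c * s) c.
      have -> : (fun s : R => 1 + c * s) = cst 1 + c \*: id by apply/funext.
      by apply: is_derive_eq; rewrite add0r [_ *: _]mulr1.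
    rewrite mulrC.
    apply: (@is_derive1_comp _ (@ln R) (fun s : R => 1 + c * s)).
    exact/is_derive1_ln/pos.
  have -> : F = (fun s : R => ln (1 + a * s)) - (fun s : R => ln (1 + b * s)) by apply/funext.
  apply: (is_derive_eq (is_deriveB (dl _ a0) (dl _ b0))).
  by rewrite /log_kernel; field; rewrite !gt_eqF ?pos.
have -> : (ln (a / b))%:E = ((ln (a / b))%:E - (F 0)%:E)%E.
  by rewrite /F !mulr0 subrr sube0.
apply: ge0_continuous_FTC2y.
- by move=> t t0; exact: log_kernel_ge0.
- apply: continuous_in_subspaceT => t; rewrite inE/= in_itv/= andbT.
  exact: continuous_log_kernel.
(* The quotient [(1 + a * t) / (1 + b * t)], rewritten so that its limit is visible. *)
- have lim : a / b + (1 - a / b) * (1 + b * t)^-1 @[t --> +oo%R] --> a / b.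
    rewrite -[X in _ --> X]addr0 -(mulr0 (1 - a / b)).
    apply: cvgD; first exact: cvg_cst.
    apply: cvgM; first exact: cvg_cst.
    apply/gtr0_cvgV0.
      near=> t; apply: pos => //; near: t; exact: nbhs_pinfty_ge.
    apply/cvgryPge => M; near=> t.
    have : M / b <= t by near: t; apply: nbhs_pinfty_ge; rewrite num_real.
    by rewrite ler_pdivrMr// mulrC => /le_trans; apply; rewrite lerDr.
  have := @cvg_comp _ _ _ _ (@ln R) _ _ _ lim (continuous_ln (divr_gt0 a0 b0)).
  apply: cvg_trans; apply: near_eq_cvg; near=> t.
  have t0 : 0 <= t by near: t; exact: nbhs_pinfty_ge.
  rewrite /= /F -ln_div ?posrE ?pos//; congr ln.
  by field; rewrite !gt_eqF ?pos.
- by move=> t t0; apply: ex_derive; exact/dF/ltW.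
- apply: cvg_at_right_filter.
  have [+ _] := dF 0 (lexx 0).
  by move/derivable1_diffP/differentiable_continuous; apply.
- move=> t; rewrite in_itv/= andbT => t0.
  by rewrite derive1E; have [_ ->] := dF t (ltW t0).
Unshelve. all: by end_near. Qed.

Lemma integrable_log_kernel a b : 0 < b <= a ->
  leb.-integrable D (EFin \o log_kernel a b).
Proof.
move=> ab; apply/integrableP; split.
  apply/measurable_EFinP; apply: subspace_continuous_measurable_fun => //.
  apply: continuous_in_subspaceT => t; rewrite inE/= in_itv/= andbT.
  exact: continuous_log_kernel.
apply: (@le_lt_trans _ _ (ln (a / b))%:E); last by rewrite ltry.
rewrite -integral_log_kernel// le_eqVlt; apply/orP; left; apply/eqP.
apply: eq_integral => t; rewrite inE/= in_itv/= andbT => t0.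
by rewrite ger0_norm// log_kernel_ge0.
Qed.

Lemma Rintegral_log_kernel a b : 0 < b <= a ->
  \int[leb]_(t in D) log_kernel a b t = ln (a / b).
Proof. by move=> ab; rewrite /Rintegral integral_log_kernel. Qed.

End log_kernel.

(** * Pointwise bound of differences of cosines by the logarithmic kernel *)

Section sine_bounds.
Context {R : realType}.
Implicit Types (a b x y t la mu : R).

Lemma abs_sin_le t : 0 <= t -> `|sin t| <= t.
Proof.
rewrite le_eqVlt => /predU1P[<-|t0]; first by rewrite sin0 normr0.
have [|c _] := @MVT R sin cos 0 t t0 (fun x _ => is_derive_sin x).
  exact/continuous_subspaceT/continuous_sin.
rewrite sin0 !subr0 => ->.
by rewrite normrM (gtr0_norm t0) ler_piMl ?cos_max// ltW.
Qed.

(** Merges the bounds by [t] and by [1] into one rational bound, whose denominator is of the kind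
    found in [log_kernel]. *)
Lemma abs_sin_frac t : 0 <= t -> `|sin t| <= 2 * t / (1 + t).
Proof.
move=> t0; have t1 : 0 < 1 + t by rewrite ltr_pwDl.
rewrite ler_pdivlMr//; have [tl|tg] := leP t 1.
  have := abs_sin_le t0; have := normr_ge0 (sin t); nra.
have := sin_max t; have := normr_ge0 (sin t); nra.
Qed.

Lemma cos_sub_cos x y : cos x - cos y = 2 * sin ((x + y) / 2) * sin ((y - x) / 2).
Proof.
have {1}-> : x = (x + y) / 2 - (y - x) / 2 by field.
have {3}-> : y = (x + y) / 2 + (y - x) / 2 by field.
by rewrite cosB cosD; ring.
Qed.

(** The difference is [2 * sin (A * t) * sin (B * t)], with [A] the half-sum and [B] the
    half-difference. The first sine yields [a / (1 + a * t)], the second [B / (1 + b * t)]; the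
    remaining factor [B] is the [mu - la] of the bound. *)
Lemma cos_diff_le_log_kernel la mu a b t :
  0 <= la -> 0 < b -> 2 * b <= mu - la -> (la + mu) / 2 <= a -> 2 * b <= a ->
  0 <= t ->
  `|cos (la * t) - cos (mu * t)| / t ^+ 2 <= 8 * (mu - la) * log_kernel a b t.
Proof.
move=> la0 b0 bmu mua ba; rewrite le_eqVlt => /predU1P[<-|t0].
  (* At [t = 0] the left side is [0], by the convention [0^-1 = 0]. *)
  rewrite expr0n/= invr0 mulr0; apply: mulr_ge0; first lra.
  by apply: log_kernel_ge0 => //; apply/andP; split; lra.
set A := (la + mu) / 2 in mua; set B := (mu - la) / 2.
have A0 : 0 < A by rewrite /A; lra.
have B0 : 0 < B by rewrite /B; lra.
have bB : b <= B by rewrite /B; lra.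
rewrite cos_sub_cos -mulrDl -mulrBl.
rewrite (_ : (la + mu) * t / 2 = A * t); last by rewrite /A; field.
rewrite (_ : (mu - la) * t / 2 = B * t); last by rewrite /B; field.
rewrite (_ : mu - la = 2 * B); last by rewrite /B; field.
rewrite !normrM (@ger0_norm _ 2)//.
have [At Bt] : 0 <= A * t /\ 0 <= B * t by split; rewrite mulr_ge0 ?ltW.
have at0 : 0 < 1 + a * t by nra.
have bt0 : 0 < 1 + b * t by nra.
have sA : `|sin (A * t)| <= 2 * t * (a / (1 + a * t)).
  apply: le_trans (abs_sin_frac At) _.
  rewrite [leRHS]mulrA ler_pdivrMr ?ltr_pwDl// [leRHS]mulrAC ler_pdivlMr//.
  by have := ler_wpM2r (ltW t0) mua; nra.
have sB : `|sin (B * t)| <= 2 * t * (B / (1 + b * t)).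
  apply: le_trans (abs_sin_frac Bt) _.
  rewrite [leRHS]mulrA ler_pdivrMr ?ltr_pwDl// [leRHS]mulrAC ler_pdivlMr//.
  by have := ler_wpM2r (ltW t0) bB; nra.
have := ler_pM (normr_ge0 _) (normr_ge0 _) sA sB.
rewrite ler_pdivrMr ?exprn_gt0// => sAB.
rewrite -mulrA; apply: le_trans (ler_wpM2l _ sAB) _ => //.
rewrite /log_kernel.
have -> : 2 * (2 * t * (a / (1 + a * t)) * (2 * t * (B / (1 + b * t)))) =
   8 * B * t ^+ 2 / ((1 + a * t) * (1 + b * t)) * a by field; rewrite !gt_eqF.
have -> : 8 * (2 * B) * ((a - b) / ((1 + a * t) * (1 + b * t))) * t ^+ 2 =
   8 * B * t ^+ 2 / ((1 + a * t) * (1 + b * t)) * (2 * (a - b)) by field; rewrite !gt_eqF.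
(* What remains is [a <= 2 * (a - b)], that is [2 * b <= a]. *)
apply: ler_wpM2l; last by lra.
have sq0 := sqr_ge0 t.
apply: divr_ge0; last exact: mulr_ge0 (ltW at0) (ltW bt0).
by apply: mulr_ge0 => //; apply: mulr_ge0 => //; exact: ltW.
Qed.

End sine_bounds.

(** * Cosine transforms on the half-line and positive definiteness *)

Section cosine_transform.
Context {R : realType}.
Local Notation leb := (@lebesgue_measure R).
Local Notation D := (`[0%R, +oo[%classic : set R).
Implicit Types (x y t : R) (f : R -> R).

Lemma continuous_cos_scale x : continuous (fun t : R => cos (x * t)).
Proof.
move=> t; apply: continuous_comp; last exact: continuous_cos.
exact: mulrl_continuous.
Qed.

Lemma measurable_cos_scale (S : set R) x :
  measurable_fun S (fun t : R => cos (x * t)).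
Proof.
apply: measurable_funTS; apply: continuous_measurable_fun.
exact: continuous_cos_scale.
Qed.

Lemma measurable_div_sqr f : continuous f -> measurable_fun D (fun t => f t / t ^+ 2).
Proof.
move=> cf; apply/measurable_fun_itv_obnd_cbndP.
apply: open_continuous_measurable_fun => // t; rewrite inE/= in_itv/= andbT => t0.
apply: cvgM; first exact: cf.
apply: cvgV; first by rewrite expf_neq0// gt_eqF.
exact: exprn_continuous.
Qed.

(** Its integral in [t] is a constant multiple of the absolute value of [x]; piecewise affine
    functions such as trapezoids are thereby integrals of cosines. *)
Definition cos_gap x t := (1 - cos (x * t)) / t ^+ 2.

Lemma cos_gap_ge0 x t : 0 <= cos_gap x t.
Proof. by rewrite divr_ge0 ?sqr_ge0// subr_ge0 cos_le1. Qed.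

Lemma measurable_cos_gap x : measurable_fun D (cos_gap x).
Proof.
apply: measurable_div_sqr => t; apply: cvgB; first exact: cvg_cst.
exact: continuous_cos_scale.
Qed.

Lemma cos_gapN x t : cos_gap (- x) t = cos_gap x t.
Proof. by rewrite /cos_gap mulNr cosN. Qed.

Lemma cos_gap_norm x t : cos_gap `|x| t = cos_gap x t.
Proof. by have [//|_] := ger0P x; rewrite cos_gapN. Qed.

(** Since [1 = cos 0], this is the cosine difference bound between the frequencies [0] and [|x|],
    with [a = |x|] and [b = |x| / 2]. *)
Lemma integrable_cos_gap x : leb.-integrable D (EFin \o cos_gap x).
Proof.
have [->|x0] := eqVneq x 0.
  rewrite (_ : _ \o _ = cst 0%E); first exact: integrable0.
  by apply/funext => t; rewrite /= /cos_gap mul0r cos0 subrr mul0r.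
have nx0 : 0 < `|x| by rewrite normr_gt0.
have h : 0 < `|x| / 2 <= `|x| by apply/andP; split; lra.
apply: (le_integrable _ _ _ (integrable_mulRl _ (8 * `|x|) (integrable_log_kernel h))) => //.
  by apply/measurable_EFinP; exact: measurable_cos_gap.
move=> t; rewrite /= in_itv/= andbT => t0.
rewrite lee_fin ger0_norm ?cos_gap_ge0// ger0_norm; last first.
  by apply: mulr_ge0; [rewrite mulr_ge0|exact: log_kernel_ge0].
have := @cos_diff_le_log_kernel R 0 `|x| `|x| (`|x| / 2) t.
rewrite mul0r cos0 subr0 => hh; rewrite -cos_gap_norm /cos_gap.
apply: le_trans (hh _ _ _ _ _ _); [|lra..].
by rewrite (@ger0_norm _ (1 - _))// subr_ge0 cos_le1.
Qed.

(** Classically equal to [pi / 2]; it serves below as a positive normalising constant. *)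
Definition cos_gap_mass : R := \int[leb]_(t in D) cos_gap 1 t.

(** The substitution [t |-> |x| * t] gives a factor [|x|^-1], against [|x|^2] from the
    denominator. *)
Lemma Rintegral_cos_gap x : \int[leb]_(t in D) cos_gap x t = `|x| * cos_gap_mass.
Proof.
have [->|x0] := eqVneq x 0.
  rewrite normr0 mul0r /Rintegral integral0_eq// => t _.
  by rewrite /cos_gap mul0r cos0 subrr mul0r.
have nx0 : 0 < `|x| by rewrite normr_gt0.
under eq_Rintegral do rewrite -cos_gap_norm.
have E t : cos_gap `|x| t = `|x| ^+ 2 * cos_gap 1 (`|x| * t).
  have [->|t0] := eqVneq t 0; first by rewrite /cos_gap !mulr0 expr0n/= invr0 !mulr0.
  by rewrite /cos_gap mul1r; field; rewrite t0 gt_eqF.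
rewrite /cos_gap_mass /Rintegral.
have := half_line_scaling nx0 (measurable_cos_gap 1)
  (fun t _ => cos_gap_ge0 1 t).
have -> : (\int[leb]_(t in D) (cos_gap `|x| t)%:E =
   (`|x| ^+ 2)%:E * \int[leb]_(t in D) (cos_gap 1 (`|x| * t))%:E)%E.
  under eq_integral do rewrite E EFinM.
  rewrite ge0_integralZl//.
  - apply/measurable_EFinP.
    apply: (@measurable_comp _ _ _ _ _ _ D) => //.
    + by move=> _ [t + <-]; rewrite /= !in_itv/= !andbT; exact: mulr_ge0.
    + exact: measurable_cos_gap.
  - by move=> t _; rewrite lee_fin cos_gap_ge0.
move=> ->.
rewrite muleA -EFinM (_ : `|x| ^+ 2 * `|x|^-1 = `|x|); last by field; rewrite gt_eqF.
by rewrite fineM//; exact: integrable_fin_num (integrable_cos_gap 1).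
Qed.

Lemma cos_gap_mass_gt0 : 0 < cos_gap_mass.
Proof.
rewrite /cos_gap_mass /Rintegral.
(* On this interval the cosine is at most [0], so the integrand is at least [pi ^- 2]. *)
pose I := `[pi / 2, pi]%classic : set R.
have pi0 := @pi_gt0 R.
have mI : measurable (I : set (measurableTypeR R)) by exact: measurable_itv.
rewrite fine_gt0//; apply/andP; split; last first.
  by rewrite -ge0_fin_numE ?integral_ge0// => [|t _];
    [exact: integrable_fin_num (integrable_cos_gap 1)|rewrite lee_fin cos_gap_ge0].
apply: (@lt_le_trans _ _ (\int[leb]_(t in I) (pi ^- 2)%:E)%E).
  have lebI : leb I = (pi / 2)%:E.
    rewrite lebesgue_measure_itv/= lte_fin ifT; last by lra.
    by rewrite -EFinB; congr EFin; field.
  rewrite integral_cst// [X in (_ * X)%E]lebI -EFinM lte_fin.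
  by rewrite mulr_gt0 ?invr_gt0 ?exprn_gt0//; lra.
apply: (@le_trans _ _ (\int[leb]_(t in I) (cos_gap 1 t)%:E)%E); last first.
  apply: ge0_subset_integral => //.
  - by apply/measurable_EFinP; exact: measurable_cos_gap.
  - by move=> t _; rewrite lee_fin cos_gap_ge0.
  - by move=> t; rewrite /I/= !in_itv/= => /andP[h _]; rewrite andbT; lra.
apply: ge0_le_integral => //.
- by move=> t _; rewrite lee_fin invr_ge0 sqr_ge0.
- apply/measurable_EFinP; apply: measurable_funS (measurable_cos_gap 1) => //.
  by move=> t; rewrite /I/= !in_itv/= => /andP[h _]; rewrite andbT; lra.
move=> t; rewrite /I/= !in_itv/= lee_fin => /andP[t1 t2].
rewrite /cos_gap mul1r -[leLHS]mul1r.
have t0 : 0 < t by lra.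
apply: ler_pM => //.
- by rewrite invr_ge0 sqr_ge0.
- rewrite -[t](subrK (pi / 2)) cosDpihalf opprK lerDl sin_ge0_pi//.
  by apply/andP; split; lra.
- by rewrite lef_pV2 ?posrE ?exprn_gt0//; rewrite ler_sqr ?nnegrE//; lra.
Qed.

Definition cos_transform f x : R := \int[leb]_(t in D) (f t * cos (x * t)).

Lemma integrable_mul_cos f x : leb.-integrable D (EFin \o f) ->
  leb.-integrable D (EFin \o (fun t => f t * cos (x * t))).
Proof.
move=> fi.
apply: (@integrable_mul_bounded _ _ _ _ _ _ _ _ 1) => //.
  exact: measurable_cos_scale.
by move=> t _; exact: cos_max.
Qed.

Lemma cos_transformN f x : cos_transform f (- x) = cos_transform f x.
Proof. by apply: eq_Rintegral => t _; rewrite mulNr cosN. Qed.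

(** Real weights are enough for later use: for even [r], the Hermitian form with complex weights is
    the sum of the forms taken at their real and imaginary parts. *)
Definition quad_form (r : R -> R) (s : seq R) (w : R -> R) : R :=
  \sum_(x <- s) \sum_(y <- s) r (x - y) * (w x * w y).

(** The easy half of Bochner's theorem: under the integral sign the form is [f t] times a sum of two
    squares, by the addition formula for the cosine. *)
Lemma quad_form_cos_transform_ge0 f s w : leb.-integrable D (EFin \o f) ->
  (forall t, 0 <= t -> 0 <= f t) -> 0 <= quad_form (cos_transform f) s w.
Proof.
move=> fi f0.
have Rsum (I : Type) (r : seq I) (h : I -> R -> R) :
    (forall i, leb.-integrable D (EFin \o h i)) ->
    leb.-integrable D (EFin \o (fun t => \sum_(i <- r) h i t)) /\
    \int[leb]_(t in D) (\sum_(i <- r) h i t) = \sum_(i <- r) \int[leb]_(t in D) h i t.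
  move=> hi; elim: r => [|i r [IH1 IH2]].
    split.
      rewrite (_ : _ \o _ = cst 0%E); first exact: integrable0.
      by apply/funext => t; rewrite /= big_nil.
    rewrite big_nil /Rintegral integral0_eq// => t _; by rewrite big_nil.
  have E : (fun t => \sum_(j <- i :: r) h j t) = (fun t => h i t + \sum_(j <- r) h j t).
    by apply/funext => t; rewrite big_cons.
  split.
    by rewrite E; exact: (integrableD _ (hi i) IH1).
  by rewrite E RintegralD// IH2 big_cons.
have hi x y : leb.-integrable D (EFin \o (fun t => f t * cos ((x - y) * t) * (w x * w y))).
  have := integrableZr _ (w x * w y) (integrable_mul_cos (x - y) fi).
  by apply.
have := (Rsum _ s _ (fun x => (Rsum _ s _ (fun y => hi x y)).1)).2.
have -> : \sum_(x <- s)
      \int[leb]_(t in D) (\sum_(y <- s) f t * cos ((x - y) * t) * (w x * w y)) =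
    quad_form (cos_transform f) s w.
  apply: eq_bigr => x _; rewrite (Rsum _ s _ (fun y => hi x y)).2.
  by apply: eq_bigr => y _; rewrite RintegralZr//; exact: integrable_mul_cos.
move=> <-; apply: Rintegral_ge0 => t; rewrite /= in_itv/= andbT => t0.
have -> : \sum_(x <- s) \sum_(y <- s) f t * cos ((x - y) * t) * (w x * w y) =
  f t * ((\sum_(x <- s) w x * cos (x * t)) ^+ 2 + (\sum_(x <- s) w x * sin (x * t)) ^+ 2).
  rewrite !expr2 !mulr_suml -big_split/= mulr_sumr; apply: eq_bigr => x _.
  rewrite !mulr_sumr -big_split/= mulr_sumr; apply: eq_bigr => y _.
  by rewrite mulrBl cosB; ring.
by rewrite mulr_ge0 ?f0// addr_ge0// sqr_ge0.
Qed.

End cosine_transform.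

(** * Trapezoids as cosine transforms, and their common majorant *)

Section trapezoid.
Context {R : realType}.
Local Notation leb := (@lebesgue_measure R).
Local Notation D := (`[0%R, +oo[%classic : set R).
Implicit Types (a b x y t la mu : R).

(* For [0 <= la < mu]: [1] on [-la, la], [0] outside [-mu, mu], affine between. *)
Definition trapezoid la mu x : R :=
  (`|x + mu| + `|x - mu| - `|x + la| - `|x - la|) / (2 * (mu - la)).

Lemma trapezoid_eq1 la mu x : la < mu -> 0 <= x <= la -> trapezoid la mu x = 1.
Proof.
move=> lamu /andP[x0 xla]; rewrite /trapezoid.
rewrite (@ger0_norm _ (x + mu)); last lra.
rewrite (@ler0_norm _ (x - mu)); last lra.
rewrite (@ger0_norm _ (x + la)); last lra.
rewrite (@ler0_norm _ (x - la)); last lra.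
by field; lra.
Qed.

Lemma trapezoid_eq0 la mu x : 0 <= la < mu -> mu <= x -> trapezoid la mu x = 0.
Proof.
move=> /andP[la0 lamu] mux; by rewrite /trapezoid !ger0_norm; lra.
Qed.

Lemma trapezoid_itv la mu x : 0 <= la < mu -> 0 <= x -> 0 <= trapezoid la mu x <= 1.
Proof.
move=> /andP[la0 lamu] x0.
have [xla|lax] := leP x la; first by rewrite trapezoid_eq1 ?ler01 ?lexx// x0.
have [mux|xmu] := leP mu x; first by rewrite trapezoid_eq0 ?ler01 ?lexx// la0.
have -> : trapezoid la mu x = (mu - x) / (mu - la).
  rewrite /trapezoid (@ger0_norm _ (x + mu)); last lra.
  rewrite (@ler0_norm _ (x - mu)); last lra.
  rewrite (@ger0_norm _ (x + la)); last lra.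
  rewrite (@ger0_norm _ (x - la)); last lra.
  by field; lra.
by apply/andP; split; [apply: divr_ge0|rewrite ler_pdivrMr]; lra.
Qed.

Lemma trapezoidN la mu x : trapezoid la mu (- x) = trapezoid la mu x.
Proof.
rewrite /trapezoid -(normrN (x + mu)) -(normrN (x - mu)).
rewrite -(normrN (x + la)) -(normrN (x - la)) !opprD !opprK.
by congr (_ / _); ring.
Qed.

Let c : R := cos_gap_mass.

Definition trapezoid_kernel la mu t :=
  (cos (la * t) - cos (mu * t)) / t ^+ 2 / (c * (mu - la)).

(** The factor [8 * (mu - la)] of [cos_diff_le_log_kernel] divided by the normalisation
    [c * (mu - la)] of the trapezoid kernel. The result no longer involves [la] and [mu], so one
    majorant serves all trapezoids. *)
Definition majorant_kernel a b t := 8 / c * log_kernel a b t.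

Let c_gt0 : 0 < c := cos_gap_mass_gt0.

Lemma integrable_majorant_kernel a b : 0 < b <= a ->
  leb.-integrable D (EFin \o majorant_kernel a b).
Proof.
by move=> ab; apply: integrable_mulRl => //; exact: integrable_log_kernel.
Qed.

Lemma trapezoid_kernel_le la mu a b t :
  0 <= la -> 0 < b -> 2 * b <= mu - la -> (la + mu) / 2 <= a -> 2 * b <= a ->
  0 <= t -> `|trapezoid_kernel la mu t| <= majorant_kernel a b t.
Proof.
move=> la0 b0 bmu mua ba t0.
have d0 : 0 < mu - la by lra.
rewrite /trapezoid_kernel /majorant_kernel 2!normrM !normfV.
rewrite (@ger0_norm _ (t ^+ 2)) ?sqr_ge0//.
rewrite (@ger0_norm _ (c * _)); last by rewrite mulr_ge0 ?ltW.
rewrite ler_pdivrMr; last by rewrite mulr_gt0.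
apply: (le_trans (cos_diff_le_log_kernel la0 b0 bmu mua ba t0)).
have cc := c_gt0; rewrite le_eqVlt; apply/orP; left; apply/eqP.
by field; rewrite gt_eqF.
Qed.

Lemma integrable_trapezoid_kernel la mu : 0 <= la < mu ->
  leb.-integrable D (EFin \o trapezoid_kernel la mu).
Proof.
move=> /andP[la0 lamu].
pose a := la + mu; pose b := (mu - la) / 2.
have ab : 0 < b <= a by apply/andP; split; rewrite /a /b; lra.
apply: (le_integrable _ _ _ (integrable_majorant_kernel ab)) => //.
  apply/measurable_EFinP; apply: measurable_funM => //.
  apply: measurable_div_sqr => t; apply: cvgB; exact: continuous_cos_scale.
move=> t; rewrite /= in_itv/= andbT => t0; rewrite lee_fin.
rewrite (le_trans _ (ler_norm _))//.
by apply: trapezoid_kernel_le => //; rewrite /a /b; lra.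
Qed.

(** The product formula for cosines turns the integrand into four terms [cos_gap], at [x + mu],
    [x - mu], [x + la] and [x - la]; their integrals are the four absolute values defining
    [trapezoid]. *)
Lemma cos_transform_trapezoid la mu x : 0 <= la < mu ->
  cos_transform (trapezoid_kernel la mu) x = trapezoid la mu x.
Proof.
move=> /andP[la0 lamu]; have c0 := c_gt0.
pose k := (2 * c * (mu - la))^-1.
have mD : measurable (D : set (measurableTypeR R)) by exact: measurable_itv.
have gi y := integrable_cos_gap y.
have gD y z := integrable_addR mD (gi y) (gi z).
have E t : trapezoid_kernel la mu t * cos (x * t) =
    k * ((cos_gap (x + mu) t + cos_gap (x - mu) t) -
         (cos_gap (x + la) t + cos_gap (x - la) t)).
  have -> : cos_gap (x + mu) t + cos_gap (x - mu) t =
      2 * (1 - cos (x * t) * cos (mu * t)) / t ^+ 2.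
    by rewrite /cos_gap [(x + mu) * t]mulrDl [(x - mu) * t]mulrBl cosD cosB; ring.
  have -> : cos_gap (x + la) t + cos_gap (x - la) t =
      2 * (1 - cos (x * t) * cos (la * t)) / t ^+ 2.
    by rewrite /cos_gap [(x + la) * t]mulrDl [(x - la) * t]mulrBl cosD cosB; ring.
  rewrite /trapezoid_kernel /k; move: (t ^+ 2)^-1 => u.
  by field; rewrite !gt_eqF//= subr_gt0.
rewrite /cos_transform; under eq_Rintegral do rewrite E.
rewrite RintegralZl//; last exact: (integrable_subR mD (gD _ _) (gD _ _)).
rewrite RintegralB//; [|exact: gD..].
rewrite !RintegralD// !Rintegral_cos_gap -/c /k /trapezoid.
by field; rewrite !gt_eqF//= subr_gt0.
Qed.

(* [V +- T] is the cosine transform of the nonnegative kernel [Psi +- psi], hence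
   positive definite: this is how a pointwise bound of kernels on the line is
   transported to an arbitrary group. *)
Lemma quad_form_trapezoid_le la mu a b s w :
  0 <= la -> 0 < b -> 2 * b <= mu - la -> (la + mu) / 2 <= a -> 2 * b <= a ->
  `|quad_form (trapezoid la mu) s w|
    <= quad_form (cos_transform (majorant_kernel a b)) s w.
Proof.
move=> la0 b0 bmu mua ba.
have mD : measurable (D : set (measurableTypeR R)) by exact: measurable_itv.
have lamu : 0 <= la < mu by rewrite la0/=; lra.
have ab : 0 < b <= a by rewrite b0/=; lra.
have Mi := integrable_majorant_kernel ab.
have Ti := integrable_trapezoid_kernel lamu.
have le t : 0 <= t -> `|trapezoid_kernel la mu t| <= majorant_kernel a b t.
  exact: trapezoid_kernel_le.
rewrite ler_norml; apply/andP; split; rewrite -subr_ge0 ?opprK.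
  have := @quad_form_cos_transform_ge0 R _ s w (integrable_addR mD Ti Mi).
  rewrite (_ : quad_form _ s w = quad_form (trapezoid la mu) s w +
    quad_form (cos_transform (majorant_kernel a b)) s w).
    by apply => t t0; rewrite -lerBlDr sub0r; have := le t t0; rewrite ler_norml => /andP[].
  rewrite -big_split/=; apply: eq_bigr => x _; rewrite -big_split/=; apply: eq_bigr => y _.
  rewrite -mulrDl -cos_transform_trapezoid//; congr (_ * _).
  rewrite -RintegralD//; [|exact: integrable_mul_cos..].
  by apply: eq_Rintegral => t _; rewrite -mulrDl.
have := @quad_form_cos_transform_ge0 R _ s w (integrable_subR mD Mi Ti).
rewrite (_ : quad_form _ s w = quad_form (cos_transform (majorant_kernel a b)) s w -
   quad_form (trapezoid la mu) s w).
  by apply => t t0; rewrite subr_ge0; have := le t t0; rewrite ler_norml => /andP[].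
rewrite -sumrB/=; apply: eq_bigr => x _; rewrite -sumrB/=; apply: eq_bigr => y _.
rewrite -mulrBl -cos_transform_trapezoid//; congr (_ * _).
rewrite -RintegralB//; [|exact: integrable_mul_cos..].
by apply: eq_Rintegral => t _; rewrite -mulrBl.
Qed.

Lemma cos_transform_majorant0 a b : 0 < b <= a ->
  cos_transform (majorant_kernel a b) 0 = 8 / c * ln (a / b).
Proof.
move=> ab; rewrite /cos_transform; under eq_Rintegral do rewrite mul0r cos0 mulr1.
by rewrite RintegralZl ?Rintegral_log_kernel//; exact: integrable_log_kernel.
Qed.

End trapezoid.

(** * Almost invariant finite sets of frequencies *)

(** Otherwise [a] grows at least like the powers of [(q + 1) / q], which eventually exceed any
    polynomial. *)
Lemma slow_growth_step (a : nat -> nat) (d q : nat) : (0 < q)%N ->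
  (0 < a 0)%N -> (forall k, a k <= k.+1 ^ d)%N ->
  exists k, (q * a k.+1 <= q.+1 * a k)%N.
Proof.
move=> q0 a0 ad; apply: contrapT => /forallNP grow.
have lowb k : (q.+1 ^ k <= q ^ k * a k)%N.
  elim: k => [|k IH]; first by rewrite !expn0 mul1n.
  have /negP := grow k; rewrite -ltnNge => /ltnW h.
  rewrite !expnS; apply: leq_trans (leq_mul (leqnn _) IH) _.
  by have := leq_mul (leqnn (q ^ k)) h; nia.
(* Bernoulli's inequality for [(1 + 1 / q) ^ m], with denominators cleared. *)
have bernoulli m : (q ^ m * (q + m) <= q * q.+1 ^ m)%N.
  elim: m => [|m IH]; first by rewrite !expn0 mul1n muln1 addn0.
  by rewrite !expnS; have := leq_mul (leqnn q.+1) IH; nia.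
(* The growth is tested at the index [m * d.+1]: Bernoulli raised to the power [d.+1] beats degree
   [d], and would force [m <= q ^ d.+1 * d.+2 ^ d]. *)
pose m := (q ^ d.+1 * d.+2 ^ d).+1.
have h : (q ^ (m * d.+1) * (q + m) ^ d.+1 <= q ^ (m * d.+1) * (q ^ d.+1 * (m * d.+1).+1 ^ d))%N.
  rewrite expnM -expnMn; apply: (@leq_trans ((q * q.+1 ^ m) ^ d.+1)).
    by rewrite leq_exp2r.
  rewrite expnMn -!expnM mulnCA leq_mul2l; apply/orP; right.
  by apply: leq_trans (lowb _) _; rewrite leq_mul2l ad orbT.
have m0 : (0 < m)%N by [].
have {h} : (m ^ d.+1 <= m ^ d * (q ^ d.+1 * d.+2 ^ d))%N.
  apply: (@leq_trans ((q + m) ^ d.+1)); first by rewrite leq_exp2r// leq_addl.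
  move: h; rewrite leq_pmul2l ?expn_gt0 ?q0// => /leq_trans; apply.
  rewrite mulnCA leq_mul2l -expnMn; apply/orP; right.
  case: (d) => [|e]; first by rewrite !expn0.
  by rewrite leq_exp2r// [(m * e.+3)%N]mulnS addnC -addn1 leq_add2l.
by rewrite expnSr leq_pmul2l ?expn_gt0// ltnn.
Qed.

Section folner.
Context {R : realType}.
Implicit Types (A : seq R) (x : R) (lambda : nat -> R).

(** The coefficient of [h_x] in the Fejer-type kernel [|A|^-1 |sum_(g in A) h_g|^2]. For
    duplicate-free [A] it is also the proportion of [A] that translation by [x] keeps inside [A]. *)
Definition diff_density A x : R :=
  (\sum_(g <- A) \sum_(g' <- A) (g - g' == x)%:R) / (size A)%:R.

Lemma diff_densityE A x : uniq A ->
  diff_density A x = (count (fun g => g + x \in A) A)%:R / (size A)%:R.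
Proof.
move=> uA; congr (_ / _); rewrite exchange_big/= -sum1_count natr_sum.
rewrite [RHS]big_mkcond/=; apply: eq_bigr => g' _.
have [gA|gA] := boolP (g' + x \in A).
  rewrite (bigD1_seq (g' + x))//= addrAC subrr add0r eqxx.
  rewrite big1 ?addr0// => g /negPf gne.
  by rewrite subr_eq addrC gne.
rewrite big_seq big1// => g gin.
by case: eqP => // /eqP; rewrite subr_eq addrC => /eqP gE; rewrite -gE gin in gA.
Qed.

Lemma diff_density_itv A x : uniq A -> 0 <= diff_density A x <= 1.
Proof.
move=> uA; rewrite diff_densityE//; apply/andP; split.
  by rewrite divr_ge0.
case: A uA => [|g A] uA; first by rewrite invr0 mulr0 ler01.
by rewrite ler_pdivrMr ?ltr0n// mul1r ler_nat count_size.
Qed.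

(* The boxes [{sum_j n_j lambda_j : n_j <= k}] have polynomial size in [k], so some
   box is almost invariant under the translations by [lambda_0, ..., lambda_N]. *)
Lemma folner_set lambda (N : nat) : exists A,
  [/\ uniq A, (0 < size A)%N,
      forall x, x \in A -> exists n : 'I_N.+1 -> nat,
        x = \sum_(j < N.+1) lambda j *+ n j &
      \sum_(j < N.+1) (1 - diff_density A (lambda j)) <= 1].
Proof.
pose val k (n : {ffun 'I_N.+1 -> 'I_k.+1}) := \sum_(j < N.+1) lambda j *+ n j.
(* Distinct exponent vectors may give the same frequency, hence [undup]. *)
pose box k := undup [seq val k n | n : {ffun 'I_N.+1 -> 'I_k.+1}].
have boxP k x : reflect (exists n : 'I_N.+1 -> nat,
    (forall j, n j <= k)%N /\ x = \sum_(j < N.+1) lambda j *+ n j) (x \in box k).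
  rewrite mem_undup; apply: (iffP mapP) => [[n _ ->]|[n [nk ->]]].
    by exists (fun j => nat_of_ord (n j)); split => // j; rewrite -ltnS.
  exists [ffun j => inord (n j)]; first by rewrite mem_enum.
  by apply: eq_bigr => j _; rewrite ffunE inordK// ltnS.
have ubox k : uniq (box k) by exact: undup_uniq.
have box0 k : 0 \in box k.
  by apply/boxP; exists (fun=> 0%N); split=> //; rewrite big1.
have sub k : {subset box k <= box k.+1}.
  by move=> x /boxP[n [nk ->]]; apply/boxP; exists n; split => // j; exact: leqW.
have shift k (j : 'I_N.+1) x : x \in box k -> x + lambda j \in box k.+1.
  move=> /boxP[n [nk ->]]; apply/boxP; exists (fun i => n i + (i == j))%N; split.
    by move=> i; rewrite -[k.+1]addn1 leq_add// leq_b1.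
  under [RHS]eq_bigr do rewrite mulrnDr.
  rewrite big_split/=; congr (_ + _).
  by rewrite (bigD1 j)//= eqxx big1 ?addr0// => i /negPf ->.
have size_box k : (size (box k) <= k.+1 ^ N.+1)%N.
  apply: leq_trans (size_undup _) _.
  by rewrite size_map -cardE card_ffun !card_ord.
have box_gt0 k : (0 < size (box k))%N.
  by have := box0 k; case: (box k).
(* The growth ratio [1 + 1 / (N + 1)] makes each of the [N + 1] defects at most [1 / (N + 1)], so
   that they add up to at most [1]. *)
have [k hk] := @slow_growth_step (fun k => size (box k)) N.+1 N.+1 isT (box_gt0 0%N) size_box.
exists (box k); split => //.
  by move=> x /boxP[n [_ ->]]; exists n.
pose P (j : 'I_N.+1) (g : R) := g + lambda j \in box k.
(* The translates by [lambda j] that leave [box k] are disjoint from it and still lie in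
   [box k.+1]. *)
have card (j : 'I_N.+1) :
    (size (box k) - count (P j) (box k) + size (box k) <= size (box k.+1))%N.
  have -> : (size (box k) - count (P j) (box k) = count (predC (P j)) (box k))%N.
    by rewrite -[in X in (X - _)%N](count_predC (P j)) addKn.
  rewrite -size_filter -(size_map (fun g => g + lambda j)) -size_cat.
  apply: uniq_leq_size.
    rewrite cat_uniq ubox andbT map_inj_uniq ?filter_uniq//; last exact: addIr.
    apply/hasPn => x xk; apply/negP => /mapP[g]; rewrite mem_filter/= => /andP[/negP gk _] xE.
    by apply: gk; rewrite /P -xE.
  move=> x; rewrite mem_cat => /orP[/mapP[g]|/sub//].
  by rewrite mem_filter => /andP[_ gk] ->; exact: shift.
apply: (@le_trans _ _ (\sum_(j < N.+1) N.+1%:R^-1 : R)); last first.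
  by rewrite sumr_const card_ord -[leLHS]mulr_natr mulVf ?pnatr_eq0.
apply: ler_sum => j _; rewrite diff_densityE//.
have s0 : 0 < (size (box k))%:R :> R by rewrite ltr0n.
rewrite -[X in X - _](@divff _ (size (box k))%:R) ?gt_eqF// -mulrBl.
rewrite -natrB ?count_size// -/(P j) ler_pdivrMr// mulrC ler_pdivlMr ?ltr0n// -natrM ler_nat.
have := card j; move: hk (size (box k) - _)%N => hk e he.
by rewrite mulnC; nia.
Qed.

End folner.

(** * Characters and integration on the group *)

Section characters.
Context {R : realType} {G : topologicalZmodType}.
Implicit Types (chi h : G -> R[i]) (beta : R -> G) (x y : R).

Lemma normc_real (z : R[i]) : (normc z)%:C = `|z|.
Proof. by []. Qed.

Lemma mulc_conj1 (z : R[i]) : normc z = 1 -> z * z^* = 1.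
Proof. by move=> z1; rewrite -sqr_normc -normc_real z1 expr1n. Qed.

Lemma normc_conj (z : R[i]) : normc z^* = normc z.
Proof. by apply: complexI; exact: normcJ. Qed.

Lemma character0 chi : is_character chi -> chi 0 = 1.
Proof.
move=> [_ chiD chi1]; have := chiD 0 0; rewrite addr0 => /eqP.
have nz : chi 0 != 0.
  by apply/eqP => z; have := chi1 0; rewrite z normc0 => /eqP; rewrite eq_sym oner_eq0.
by rewrite -[X in X == _]mul1r => /eqP /(mulIf nz).
Qed.

Lemma characterN chi w : is_character chi -> chi (- w) = (chi w)^*.
Proof.
move=> /[dup] chic [_ chiD chi1].
have := mulc_conj1 (chi1 w); rewrite -{1}(character0 chic) -(subrr w) chiD => h.
have nz : chi w != 0.
  by apply/eqP => z; have := chi1 w; rewrite z normc0 => /eqP; rewrite eq_sym oner_eq0.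
by apply/esym/(mulfI nz).
Qed.

Lemma characterB chi v w : is_character chi -> chi (v - w) = chi v * (chi w)^*.
Proof. by move=> chic; have [_ chiD _] := chic; rewrite chiD characterN. Qed.

Lemma is_character1 : is_character (fun _ : G => 1 : R[i]).
Proof.
by split => [w|v w|w]; [exact: cvg_cst|rewrite mulr1|exact: normc1].
Qed.

Lemma is_character_conj chi : is_character chi -> is_character (fun w => (chi w)^*).
Proof.
move=> /[dup] chic [cchi chiD chi1]; split => [|v w|w].
- have -> : (fun w => (chi w)^*) = chi \o -%R.
    by apply/funext => w; rewrite /= characterN.
  by move=> w; apply: continuous_comp; [exact: opp_continuous|exact: cchi].
- by rewrite chiD rmorphM.
- by rewrite normc_conj.
Qed.

Lemma is_characterM chi chi' : is_character chi -> is_character chi' ->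
  is_character (fun w => chi w * chi' w).
Proof.
move=> [c1 D1 n1] [c2 D2 n2]; split => [w|v w|w].
- by apply: cvgM; [exact: c1|exact: c2].
- by rewrite D1 D2 mulrACA.
- by rewrite normcM n1 n2 mulr1.
Qed.

Lemma abs_Re_le (z : R[i]) : `|complex.Re z| <= normc z.
Proof. by rewrite -lecR; exact: normc_ge_Re. Qed.

Lemma abs_Im_le (z : R[i]) : `|complex.Im z| <= normc z.
Proof.
rewrite -[complex.Im z]opprK normrN -ReiNIm (le_trans (abs_Re_le _))//.
by rewrite normcM /normc/= expr0n/= expr1n add0r sqrtr1 mulr1.
Qed.

Lemma continuous_Re chi : continuous (chi : G -> (R[i] : numClosedFieldType)) ->
  continuous (fun w => complex.Re (chi w)).
Proof.
move=> cchi w; apply/cvgrPdist_lt => e e0.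
have /cvgrPdist_lt /(_ e%:C) := cchi w; rewrite ltcR => /(_ e0).
apply: filterS => v; rewrite -normc_real ltcR; apply: le_lt_trans.
by rewrite -raddfB abs_Re_le.
Qed.

Lemma continuous_Im chi : continuous (chi : G -> (R[i] : numClosedFieldType)) ->
  continuous (fun w => complex.Im (chi w)).
Proof.
move=> cchi w; apply/cvgrPdist_lt => e e0.
have /cvgrPdist_lt /(_ e%:C) := cchi w; rewrite ltcR => /(_ e0).
apply: filterS => v; rewrite -normc_real ltcR; apply: le_lt_trans.
by rewrite -raddfB abs_Im_le.
Qed.

(** The set where [f] and [g] differ is open; were it nonempty, it would meet [S]. *)
Lemma dense_eq (f g : G -> R) (S : set G) : continuous f -> continuous g ->
  dense S -> {in S, f =1 g} -> f =1 g.
Proof.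
move=> cf cg dS fg w; apply/eqP; rewrite -subr_eq0; apply/negPn/negP => nz.
have [//||v [/= vn vS]] := dS [set v | f v - g v != 0].
- by exists w.
- apply: (@open_comp _ _ (fun v => f v - g v) [set z | z != 0]).
    by move=> v _; apply: cvgB; [exact: cf|exact: cg].
  exact: open_neq.
- by move: vn; rewrite fg ?inE// subrr eqxx.
Qed.

Lemma extends_exp_uniq beta x h h' : dense (range beta) ->
  extends_exp beta x h -> extends_exp beta x h' -> h = h'.
Proof.
move=> db [[ch _ _] hE] [[ch' _ _] hE']; apply/funext => w.
have eqp (p : R[i] -> R) : continuous (fun w => p (h w)) ->
    continuous (fun w => p (h' w)) -> p (h w) = p (h' w).
  move=> ph ph'; apply: (dense_eq ph ph' db) => v; rewrite inE => -[t _ <-].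
  by rewrite hE hE'.
have eqRe := eqp (@complex.Re R) (continuous_Re ch) (continuous_Re ch').
have eqIm := eqp (@complex.Im R) (continuous_Im ch) (continuous_Im ch').
by apply/eqP; rewrite eq_complex eqRe eqIm !eqxx.
Qed.

Lemma expiD x y : expi (x + y) = expi x * expi y.
Proof.
rewrite /expi cosD sinD; apply/eqP; rewrite eq_complex/= eqxx/=.
by rewrite addrC.
Qed.

Lemma expiN x : expi (- x) = (expi x)^*.
Proof. by rewrite /expi cosN sinN. Qed.

Lemma extends_exp0 beta : extends_exp beta 0 (fun _ : G => 1 : R[i]).
Proof.
by split; [exact: is_character1|move=> t; rewrite mul0r oppr0 /expi cos0 sin0].
Qed.

Lemma extends_expD beta x y h h' : extends_exp beta x h -> extends_exp beta y h' ->
  extends_exp beta (x + y) (fun w => h w * h' w).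
Proof.
move=> [ch hE] [ch' hE']; split; first exact: is_characterM.
by move=> t; rewrite hE hE' -expiD mulrDl opprD.
Qed.

Lemma extends_expN beta x h : extends_exp beta x h ->
  extends_exp beta (- x) (fun w => (h w)^*).
Proof.
move=> [ch hE]; split; first exact: is_character_conj.
by move=> t; rewrite hE -expiN mulNr.
Qed.

Lemma extends_expB beta x y h h' : extends_exp beta x h -> extends_exp beta y h' ->
  extends_exp beta (x - y) (fun w => h w * (h' w)^*).
Proof. by move=> hx /extends_expN; exact: extends_expD. Qed.

(** For [x != y], the constant [h * h^* = 1] would extend the exponential of frequency [x - y],
    which takes the value [-1] at [pi / (x - y)]. *)
Lemma extends_exp_inj beta x y h :
  extends_exp beta x h -> extends_exp beta y h -> x = y.
Proof.
move=> hx hy; apply/eqP; rewrite -subr_eq0; apply/negPn/negP => xy0.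
have [_ /(_ (pi / (x - y)))] := extends_expB hx hy.
have [[_ _ n1] _] := hx; rewrite mulc_conj1// mulrCA mulfV// mulr1.
rewrite /expi cosN cospi => -[/eqP].
by rewrite -subr_eq0 opprK -[1 + 1]/(2%:R) pnatr_eq0.
Qed.

Lemma dirichlet_charP beta x : (exists h, extends_exp beta x h) ->
  extends_exp beta x (dirichlet_char beta x).
Proof. by move=> [h hx]; apply: (@xgetPex _ (cst 1)); exists h. Qed.

Lemma dirichlet_char_eq beta x h : dense (range beta) ->
  extends_exp beta x h -> dirichlet_char beta x = h.
Proof.
by move=> db hx; apply: (extends_exp_uniq db _ hx); apply: dirichlet_charP; exists h.
Qed.

End characters.

(** * Complex-valued integration and orthogonality of characters *)

Section complex_integral.
Context {R : realType} {G : topologicalZmodType}.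
Variable mu : probability (borel G) R.
Implicit Types (f g : G -> R[i]) (chi : G -> R[i]) (u v : borel G -> R).

Let Rintegrable (u : borel G -> R) := mu.-integrable setT (EFin \o u).

Definition cintegrable (f : G -> R[i]) : Prop :=
  Rintegrable (fun w => complex.Re (f w)) /\ Rintegrable (fun w => complex.Im (f w)).

Lemma eq_Rintegrable u v : u =1 v -> Rintegrable u -> Rintegrable v.
Proof. by move=> /funext ->. Qed.

Lemma Re_add (y z : R[i]) : complex.Re (y + z) = complex.Re y + complex.Re z.
Proof. by case: y z => ? ? []. Qed.

Lemma Im_add (y z : R[i]) : complex.Im (y + z) = complex.Im y + complex.Im z.
Proof. by case: y z => ? ? []. Qed.

Lemma open_measurable_borel (U : set G) : open U -> measurable (U : set (borel G)).
Proof. by move=> oU; exact: sub_gen_smallest. Qed.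

Lemma continuous_measurable_borel (u : G -> R) : continuous u ->
  measurable_fun setT (u : borel G -> R).
Proof.
move=> /continuousP cu; apply: (measurability _ (RGenOpens.measurableE R)).
move=> _ [_ [a [b ->] <-]]; rewrite setTI; apply: open_measurable_borel.
exact/cu/interval_open.
Qed.

Lemma Rintegrable_const (c : R) : Rintegrable (fun=> c).
Proof. exact: finite_measure_integrable_cst. Qed.

Lemma measurable_Re_character chi : is_character chi ->
  measurable_fun setT (fun w : borel G => complex.Re (chi w)).
Proof. by move=> [cchi _ _]; apply: continuous_measurable_borel; exact: continuous_Re. Qed.

Lemma measurable_Im_character chi : is_character chi ->
  measurable_fun setT (fun w : borel G => complex.Im (chi w)).
Proof. by move=> [cchi _ _]; apply: continuous_measurable_borel; exact: continuous_Im. Qed.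

Lemma cintegrableD f g : cintegrable f -> cintegrable g ->
  cintegrable (fun w => f w + g w).
Proof.
move=> [f1 f2] [g1 g2]; split.
  apply: (eq_Rintegrable _ (integrable_addR measurableT f1 g1)) => w.
  by rewrite Re_add.
apply: (eq_Rintegrable _ (integrable_addR measurableT f2 g2)) => w.
by rewrite Im_add.
Qed.

Lemma cintegralD f g : cintegrable f -> cintegrable g ->
  cintegral mu (fun w => f w + g w) = cintegral mu f + cintegral mu g.
Proof.
move=> [f1 f2] [g1 g2]; rewrite /cintegral; apply/eqP; rewrite eq_complex/=.
rewrite -RintegralD// -[X in _ && (_ == X)]RintegralD//.
by apply/andP; split; apply/eqP; apply: eq_Rintegral => w _; rewrite ?Re_add ?Im_add.
Qed.

Lemma Re_mul (y z : R[i]) :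
  complex.Re (y * z) = complex.Re y * complex.Re z - complex.Im y * complex.Im z.
Proof. by case: y z => ? ? []. Qed.

Lemma Im_mul (y z : R[i]) :
  complex.Im (y * z) = complex.Re y * complex.Im z + complex.Im y * complex.Re z.
Proof. by case: y z => ? ? [] *; rewrite /= addrC. Qed.

Lemma cintegrableZ (c : R[i]) f : cintegrable f -> cintegrable (fun w => c * f w).
Proof.
move=> [f1 f2]; split.
  apply: (eq_Rintegrable _ (integrable_subR measurableT
    (integrable_mulRl measurableT (complex.Re c) f1)
    (integrable_mulRl measurableT (complex.Im c) f2))) => w.
  by rewrite Re_mul.
apply: (eq_Rintegrable _ (integrable_addR measurableT
  (integrable_mulRl measurableT (complex.Re c) f2)
  (integrable_mulRl measurableT (complex.Im c) f1))) => w.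
by rewrite Im_mul.
Qed.

Lemma cintegralZ (c : R[i]) f : cintegrable f ->
  cintegral mu (fun w => c * f w) = c * cintegral mu f.
Proof.
move=> [f1 f2].
have E1 := RintegralZl (complex.Re c) measurableT f1.
have E2 := RintegralZl (complex.Im c) measurableT f2.
have E3 := RintegralZl (complex.Re c) measurableT f2.
have E4 := RintegralZl (complex.Im c) measurableT f1.
have i1 := integrable_mulRl measurableT (complex.Re c) f1.
have i2 := integrable_mulRl measurableT (complex.Im c) f2.
have i3 := integrable_mulRl measurableT (complex.Re c) f2.
have i4 := integrable_mulRl measurableT (complex.Im c) f1.
apply/eqP; rewrite eq_complex Re_mul Im_mul/= -E1 -E2 -E3 -E4.
rewrite -RintegralB// -RintegralD//.
by apply/andP; split; apply/eqP; apply: eq_Rintegral => w _; rewrite ?Re_mul ?Im_mul.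
Qed.

Lemma cintegrable0 : cintegrable (fun=> 0).
Proof. by split; exact: Rintegrable_const. Qed.

Lemma cintegral0 : cintegral mu (fun=> 0) = 0.
Proof. by rewrite /cintegral/= !Rintegral_cst// !mul0r. Qed.

Lemma cintegrable_sum (I : Type) (s : seq I) (F : I -> G -> R[i]) :
  (forall i, cintegrable (F i)) -> cintegrable (fun w => \sum_(i <- s) F i w).
Proof.
move=> Fi; elim: s => [|i s IH].
  by under eq_fun do rewrite big_nil; exact: cintegrable0.
by under eq_fun do rewrite big_cons; exact: cintegrableD.
Qed.

Lemma cintegral_sum (I : Type) (s : seq I) (F : I -> G -> R[i]) :
  (forall i, cintegrable (F i)) ->
  cintegral mu (fun w => \sum_(i <- s) F i w) = \sum_(i <- s) cintegral mu (F i).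
Proof.
move=> Fi; elim: s => [|i s IH].
  by under eq_fun do rewrite big_nil; rewrite big_nil cintegral0.
under eq_fun do rewrite big_cons.
by rewrite big_cons cintegralD// ?IH//; exact: cintegrable_sum.
Qed.

Lemma cintegrable_real (u : G -> R) : Rintegrable u -> cintegrable (fun w => (u w)%:C).
Proof. by move=> ui; split=> //; exact: Rintegrable_const. Qed.

Lemma cintegral_real (u : G -> R) :
  cintegral mu (fun w => (u w)%:C) = (\int[mu]_w u w)%:C.
Proof. by rewrite /cintegral/= Rintegral_cst// mul0r. Qed.

Lemma cintegrable_mul_character f chi : cintegrable f -> is_character chi ->
  cintegrable (fun w => f w * chi w).
Proof.
move=> [f1 f2] chic; have [_ _ n1] := chic.
have r w : `|complex.Re (chi w)| <= 1 by rewrite -(n1 w) abs_Re_le.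
have i w : `|complex.Im (chi w)| <= 1 by rewrite -(n1 w) abs_Im_le.
have mr := measurable_Re_character chic; have mi := measurable_Im_character chic.
split.
  apply: (eq_Rintegrable _ (integrable_subR measurableT
    (integrable_mul_bounded measurableT f1 mr (fun w _ => r w))
    (integrable_mul_bounded measurableT f2 mi (fun w _ => i w)))) => w.
  by rewrite Re_mul.
apply: (eq_Rintegrable _ (integrable_addR measurableT
  (integrable_mul_bounded measurableT f1 mi (fun w _ => i w))
  (integrable_mul_bounded measurableT f2 mr (fun w _ => r w)))) => w.
by rewrite Im_mul.
Qed.

Lemma cintegrable_character chi : is_character chi -> cintegrable chi.
Proof.
move=> chic; have := cintegrable_mul_character (cintegrable_real (Rintegrable_const 1)) chic.
by under eq_fun do rewrite mul1r.
Qed.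

(* Rotate the integral to the positive real axis and take real parts. *)
Lemma normc_cintegral_le f (g : G -> R) : cintegrable f -> Rintegrable g ->
  (forall w, normc (f w) <= g w) -> normc (cintegral mu f) <= \int[mu]_w g w.
Proof.
move=> fi gi fg; set z := cintegral mu f.
have [->|z0] := eqVneq z 0.
  rewrite normc0; apply: Rintegral_ge0 => w _.
  by apply: le_trans (fg w); rewrite -ler0c normc_real.
have nz : normc z != 0 by apply: contra_neq z0; exact: eq0_normc.
pose u := z^* / (normc z)%:C.
have uz : u * z = (normc z)%:C.
  rewrite /u mulrAC [z^* * z]mulrC -sqr_normc -normc_real expr2 mulfK//.
  by rewrite -(rmorph0 (real_complex R)) (inj_eq (@complexI R)).
have nu : normc u = 1.
  apply: (mulIf nz); rewrite -normcM uz mul1r.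
  apply: complexI; rewrite !normc_real normr_id; exact: normc_real.
have -> : normc z = complex.Re (cintegral mu (fun w => u * f w)).
  by rewrite cintegralZ// -/z uz.
apply: le_Rintegral => //; first by have [] := cintegrableZ u fi.
move=> w _; apply: le_trans (ler_norm _) _; apply: le_trans (abs_Re_le _) _.
by rewrite normcM nu mul1r.
Qed.

Hypothesis haar : haar_probability mu.

Lemma measurable_translation (x : G) :
  measurable_fun setT (fun y : borel G => (x + y : borel G)).
Proof.
apply: (@measurability _ _ (borel G) (borel G) setT _ (@open G) erefl).
move=> _ [U oU <-]; rewrite setTI; apply: open_measurable_borel.
apply: (@open_comp G G (fun y => x + y)) => // y _.
apply: (@continuous_comp _ _ _ (fun z => (x, z)) (fun z : G * G => z.1 + z.2)).
  by apply: cvg_pair => /=; [exact: cvg_cst|exact: cvg_id].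
exact: add_continuous.
Qed.

Lemma haar_translation (x : G) (u : borel G -> R) : Rintegrable u ->
  measurable_fun setT u -> Rintegrable (fun y : borel G => u (x + y)) ->
  \int[mu]_y u (x + y) = \int[mu]_y u y.
Proof.
move=> ui um uxi; rewrite /Rintegral; congr fine.
have := @integral_pushforward _ _ (borel G) (borel G) R _ (measurable_translation x) mu setT
  (EFin \o u).
rewrite preimage_setT => <- //; last exact/measurable_EFinP.
apply: eq_measure_integral; first exact: measurable_translation.
move=> ? A mA _.
have [inv _ _] := haar.
(* Invariance is stated for images of sets; the preimage under translation by [x] is the image under
   translation by [- x]. *)
apply: (etrans _ (inv (- x) A mA)).
rewrite /pushforward/=; congr (mu _); apply/seteqP; split => y /=.
  by move=> Ay; exists (x + y) => //; rewrite addrA addNr add0r.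
by move=> [z Az <-]; rewrite addrA subrr add0r.
Qed.

(** If [chi x != 1], translating by [x] multiplies the integral by [chi x] without changing it, so
    the integral vanishes. *)
Lemma cintegral_character chi : is_character chi ->
  cintegral mu chi = (chi == (fun=> 1))%:R.
Proof.
move=> /[dup] chic [_ chiD n1]; have [->|chi1] := eqVneq.
  rewrite (@cintegral_real (fun=> 1)) Rintegral_cst// mul1r.
  apply: (@congr1 _ _ (fun e => (fine e)%:C) _ 1%E); exact: probability_setT.
have [x chix] : exists x, chi x != 1.
  apply: contrapT => /forallNP h; move/eqP: chi1; apply; apply/funext => x.
  by have /negP := h x; rewrite negbK => /eqP.
have ci := cintegrable_character chic; have [c1 c2] := ci.
have tr : cintegral mu (fun w => chi x * chi w) = cintegral mu chi.
  have [d1 d2] := cintegrableZ (chi x) ci.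
  have E w : chi x * chi w = chi (x + w) by rewrite chiD.
  move: d1 d2; under eq_fun do rewrite E; move=> d1.
  under eq_fun do rewrite E; move=> d2.
  rewrite /cintegral; congr (_ +i* _); under eq_Rintegral do rewrite E.
    exact: (haar_translation c1 (measurable_Re_character chic) d1).
  exact: (haar_translation c2 (measurable_Im_character chic) d2).
move: tr; rewrite cintegralZ// => /eqP; rewrite -subr_eq0 -[X in _ - X]mul1r -mulrBl.
by rewrite mulf_eq0 subr_eq0 (negPf chix)/= => /eqP.
Qed.

End complex_integral.

(** * The convexity inequality behind Jensen's inequality *)

Section jensen.
Context {R : realType}.

(** The graph of the [p]-th power lies above its tangent at [u]. For [p > 1] this is Young's
    inequality with exponents [p] and [p / (p - 1)]; [p = 1], where the latter degenerates, is
    treated apart. *)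
Lemma powR_tangent (p x u : R) : 1 <= p -> 0 <= x -> 0 <= u ->
  p * (x * u `^ (p - 1)) <= x `^ p + (p - 1) * u `^ p.
Proof.
rewrite le_eqVlt => /predU1P[<-|p1] x0 u0.
  by rewrite subrr powRr0 mulr1 mul1r mul0r addr0 powRr1.
have p0 : 0 < p by rewrite (lt_trans ltr01).
have p10 : p - 1 != 0 by rewrite subr_eq0 gt_eqF.
have pn0 : p != 0 by rewrite gt_eqF.
have q0 : 0 < p / (p - 1) by rewrite divr_gt0// subr_gt0.
have pq : p^-1 + (p / (p - 1))^-1 = 1.
  by field; rewrite ?pn0 ?p10.
have := conjugate_powR x0 (powR_ge0 u (p - 1)) p0 q0 pq.
rewrite -powRrM (_ : (p - 1) * (p / (p - 1)) = p); last first.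
  by field; rewrite ?pn0 ?p10.
rewrite -(ler_pM2l p0) => /le_trans; apply.
rewrite le_eqVlt; apply/orP; left; apply/eqP.
by field; rewrite ?pn0 ?p10.
Qed.

End jensen.

(** * Trigonometric polynomials and convolution with them *)

Section trigonometric_polynomials.
Context {R : realType} {G : topologicalZmodType}.
Variable mu : probability (borel G) R.
Hypothesis haar : haar_probability mu.
Variable beta : R -> G.

Local Notation h := (dirichlet_char beta).

(** This holds for every real [x], because the default value [cst 1] is itself a character. *)
Lemma is_character_dirichlet_char (x : R) : is_character (h x).
Proof.
rewrite /dirichlet_char; case: xgetP => [_ _ [//]|_]; exact: is_character1.
Qed.

Let hc := is_character_dirichlet_char.

(* Coefficient-frequency pairs; frequencies may be repeated. *)
Definition trig (s : seq (R * R)) (w : G) : R[i] :=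
  \sum_(u <- s) u.1%:C * h u.2 w.

(** The integral of [trig s] read off its coefficients: by orthogonality only the trivial character
    contributes. *)
Definition trig_mean (s : seq (R * R)) : R :=
  \sum_(u <- s) u.1 * (h u.2 == (fun=> 1))%:R.

Lemma fourier_integrable f (x : R) : cintegrable mu f ->
  cintegrable mu (fun v => f v * (h x v)^*).
Proof. by move=> fi; apply: cintegrable_mul_character => //; exact: is_character_conj. Qed.

(** Separates the variables, which turns convolution with [trig s] into a finite combination of
    Fourier coefficients. *)
Lemma trigB s v w : trig s (w - v) = \sum_(u <- s) u.1%:C * h u.2 w * (h u.2 v)^*.
Proof. by apply: eq_bigr => u _; rewrite characterB// mulrA. Qed.

Lemma cintegrable_conv_trig f s w : cintegrable mu f ->
  cintegrable mu (fun v => f v * trig s (w - v)).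
Proof.
move=> fi.
have -> : (fun v => f v * trig s (w - v)) =
    (fun v => \sum_(u <- s) (u.1%:C * h u.2 w) * (f v * (h u.2 v)^*)).
  by apply/funext => v; rewrite trigB mulr_sumr; apply: eq_bigr => u _; rewrite mulrCA.
by apply: cintegrable_sum => u; apply: cintegrableZ; exact: fourier_integrable.
Qed.

Lemma conv_trig f s w : cintegrable mu f ->
  cintegral mu (fun v => f v * trig s (w - v)) =
  \sum_(u <- s) u.1%:C * (fourier mu f (h u.2) * h u.2 w).
Proof.
move=> fi.
have -> : (fun v => f v * trig s (w - v)) =
    (fun v => \sum_(u <- s) (u.1%:C * h u.2 w) * (f v * (h u.2 v)^*)).
  by apply/funext => v; rewrite trigB mulr_sumr; apply: eq_bigr => u _; rewrite mulrCA.
rewrite cintegral_sum; last by move=> u; apply: cintegrableZ; exact: fourier_integrable.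
apply: eq_bigr => u _; rewrite cintegralZ; last exact: fourier_integrable.
by rewrite -mulrA [X in _ * X]mulrC.
Qed.

Lemma conv_trig_trig f s : cintegrable mu f ->
  (fun w => cintegral mu (fun v => f v * trig s (w - v))) =
  (fun w => \sum_(u <- s) (u.1%:C * fourier mu f (h u.2)) * h u.2 w).
Proof.
by move=> fi; apply/funext => w; rewrite conv_trig//; apply: eq_bigr => u _; rewrite mulrA.
Qed.

Lemma cintegrable_conv f s : cintegrable mu f ->
  cintegrable mu (fun w => cintegral mu (fun v => f v * trig s (w - v))).
Proof.
move=> fi; rewrite conv_trig_trig//; apply: cintegrable_sum => u.
by apply: cintegrableZ; exact: cintegrable_character.
Qed.

(** Termwise integration takes the place of exchanging two integrals: only trivial characters
    survive, and there the Fourier coefficient of [f] is its integral. *)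
Lemma cintegral_conv f s : cintegrable mu f ->
  cintegral mu (fun w => cintegral mu (fun v => f v * trig s (w - v))) =
  (trig_mean s)%:C * cintegral mu f.
Proof.
move=> fi; rewrite conv_trig_trig// cintegral_sum; last first.
  by move=> u; apply: cintegrableZ; exact: cintegrable_character.
rewrite /trig_mean rmorph_sum/= mulr_suml; apply: eq_bigr => u _.
rewrite cintegralZ; last exact: cintegrable_character.
rewrite cintegral_character//; have [h1|_] := eqVneq; last first.
  by rewrite !mulr0 rmorph0 mul0r.
rewrite !mulr1 /fourier h1; congr (_ * _); congr cintegral.
by apply/funext => v; apply: etrans (mulr1 (f v)); congr (_ * _); exact: conjc1.
Qed.

Lemma conv_trig1 s w :
  cintegral mu (fun v => 1%:C * trig s (w - v)) = (trig_mean s)%:C.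
Proof.
rewrite (@conv_trig (fun=> 1%:C)); last exact/cintegrable_real/Rintegrable_const.
rewrite /trig_mean rmorph_sum/=; apply: eq_bigr => u _; rewrite /fourier.
have -> : cintegral mu (fun v => 1%:C * (h u.2 v)^*) = (h u.2 == (fun=> 1))%:R.
  under eq_fun do rewrite mul1r.
  rewrite cintegral_character//; last exact: is_character_conj.
  congr (nat_of_bool _)%:R; apply/eqP/eqP => E; apply/funext => v.
    have Ev : (h u.2 v)^* = 1 := congr1 (fun k => k v) E.
    by rewrite -[h u.2 v]conjcK Ev conjc1.
  by rewrite E; exact: conjc1.
have [->|_] := eqVneq; first by rewrite !mulr1.
by rewrite mul0r !mulr0.
Qed.

Lemma measurable_normc (f : G -> R[i]) :
  measurable_fun setT (fun w : borel G => complex.Re (f w)) ->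
  measurable_fun setT (fun w : borel G => complex.Im (f w)) ->
  measurable_fun setT (fun w : borel G => normc (f w)).
Proof.
move=> mr mi.
have -> : (fun w : borel G => normc (f w)) =
    Num.sqrt \o (fun w => complex.Re (f w) ^+ 2 + complex.Im (f w) ^+ 2).
  by apply/funext => w; rewrite /=; case: (f w).
apply: measurableT_comp; first by apply: continuous_measurable_fun; exact: sqrt_continuous.
by apply: measurable_funD; exact: measurable_funX.
Qed.

(** * Jensen's inequality for convolution with a nonnegative trigonometric polynomial *)

Variables (W : seq (R * R)) (Wr : G -> R).
Hypothesis trigW : forall w, trig W w = (Wr w)%:C.
Hypothesis Wr_ge0 : forall w, 0 <= Wr w.
Hypothesis W_mean_gt0 : 0 < trig_mean W.

Let V := trig_mean W.

Lemma Rintegrable_conv (u : G -> R) w : mu.-integrable setT (EFin \o (u : borel G -> R)) ->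
  mu.-integrable setT (EFin \o (fun v : borel G => u v * Wr (w - v))).
Proof.
move=> ui; have [+ _] := cintegrable_conv_trig W w (cintegrable_real ui).
by apply: eq_Rintegrable => v; rewrite trigW -rmorphM.
Qed.

Lemma conv_real (u : G -> R) w :
  cintegral mu (fun v => (u v)%:C * trig W (w - v)) =
  (\int[mu]_v (u v * Wr (w - v)))%:C.
Proof.
rewrite -cintegral_real; congr cintegral; apply/funext => v.
by rewrite trigW -rmorphM.
Qed.

Lemma conv_powR_le (a : G -> R) (p : R) w : 1 <= p -> (forall v, 0 <= a v) ->
  mu.-integrable setT (EFin \o (a : borel G -> R)) ->
  mu.-integrable setT (EFin \o (fun v : borel G => a v `^ p)) ->
  (\int[mu]_v (a v * Wr (w - v))) `^ p <=
  V `^ (p - 1) * \int[mu]_v (a v `^ p * Wr (w - v)).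
Proof.
move=> p1 a0 ai api; set U := \int[mu]_v _.
have p0 : 0 < p by rewrite (lt_le_trans ltr01).
have U0 : 0 <= U by apply: Rintegral_ge0 => v _; rewrite mulr_ge0.
have V0 : 0 < V := W_mean_gt0.
(* The mean of [a] for the probability density [Wr (w - v) / V]. Taking the tangent at this point
   makes the integrated linear term equal to [p * x ^ p * V]. *)
pose x := U / V; have x0 : 0 <= x by rewrite divr_ge0// ltW.
have UE : U = x * V by rewrite /x mulfVK// gt_eqF.
have WV : \int[mu]_v Wr (w - v) = V.
  apply: complexI; rewrite /V -(conv_trig1 W w) conv_real.
  by congr (_%:C); apply: eq_Rintegral => v _; rewrite mul1r.
have Wi : mu.-integrable setT (EFin \o (fun v : borel G => Wr (w - v))).
  apply: eq_Rintegrable (Rintegrable_conv w (Rintegrable_const mu 1)) => v.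
  by rewrite mul1r.
have i1 := Rintegrable_conv w ai; have i2 := Rintegrable_conv w api.
have i3 := integrable_mulRl measurableT ((p - 1) * x `^ p) Wi.
have i4 := integrable_mulRl measurableT (p * x `^ (p - 1)) i1.
have : \int[mu]_v ((p * x `^ (p - 1)) * (a v * Wr (w - v))) <=
    \int[mu]_v (a v `^ p * Wr (w - v) + (p - 1) * x `^ p * Wr (w - v)).
  apply: le_Rintegral => //; first exact: integrable_addR.
  move=> v _; have := ler_wpM2r (Wr_ge0 (w - v)) (powR_tangent p1 (a0 v) x0).
  by rewrite mulrDl; apply: le_trans; rewrite le_eqVlt; apply/orP; left; apply/eqP; ring.
rewrite RintegralZl// RintegralD// [X in _ <= _ + X]RintegralZl// -/U WV.
set I := \int[mu]_v (a v `^ p * _) => H.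
have xp : x * x `^ (p - 1) = x `^ p by rewrite mulr_powRB1.
have {}H : x `^ p * V <= I.
  by move: H; rewrite UE -xp; lra.
rewrite UE powRM ?(ltW V0)// -(mulr_powRB1 (ltW V0) p0) mulrA mulrC.
by rewrite ler_wpM2l ?powR_ge0.
Qed.

End trigonometric_polynomials.

(** * From a common majorant of the kernels to the maximal inequality *)

Section maximal_inequality.
Context {R : realType} {G : topologicalZmodType}.
Variable mu : probability (borel G) R.
Hypothesis haar : haar_probability mu.
Variable beta : R -> G.
Implicit Types (f : G -> R[i]) (p : R).

Lemma normc_ge0 (z : R[i]) : 0 <= normc z.
Proof. by rewrite -ler0c normc_real. Qed.

Lemma measurable_bigmax d (T : measurableType d) (I : Type) (r : seq I) (F : I -> T -> R) :
  (forall i, measurable_fun setT (F i)) ->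
  measurable_fun setT (fun w => \big[Num.max/0]_(i <- r) F i w).
Proof.
move=> mF; elim: r => [|i r IH].
  by under eq_fun do rewrite big_nil; exact: measurable_cst.
by under eq_fun do rewrite big_cons; exact: measurable_maxr.
Qed.

Lemma cLnormE p f : cLnorm mu p%:E f = ((\int[mu]_w (normc (f w) `^ p)%:E) `^ p^-1)%E.
Proof.
rewrite /cLnorm unlock /=; congr poweR; apply: eq_integral => w _.
by rewrite ger0_norm// normc_ge0.
Qed.

Section Lp_function.
Variables (p : R) (f : G -> R[i]).
Hypothesis (p1 : 1 <= p) (fp : Lp mu p%:E f).

Let p0 : 0 < p.
Proof. by rewrite (lt_le_trans ltr01). Qed.

Lemma Lp_measurable_normc : measurable_fun setT (fun w : borel G => normc (f w)).
Proof. by have [mr mi _] := fp; exact: measurable_normc. Qed.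

Lemma Lp_integrable_powR :
  mu.-integrable setT (EFin \o (fun w : borel G => normc (f w) `^ p)).
Proof.
have [_ _] := fp; rewrite cLnormE => foo.
apply/integrableP; split.
  apply/measurable_EFinP.
  exact: (measurableT_comp (measurable_powR p) Lp_measurable_normc).
have -> : (\int[mu]_w `|(EFin \o (fun w => normc (f w) `^ p)%R) w| =
    \int[mu]_w (normc (f w) `^ p)%:E)%E.
  by apply: eq_integral => w _; rewrite /= ger0_norm// powR_ge0.
(* An infinite integral would give an infinite norm, as the exponent [p^-1] is nonzero. *)
move: foo; case: (\int[mu]_w _)%E => [r _|/=|_]; [exact: ltry| |by []].
by rewrite ifF//; apply/negbTE; rewrite invr_eq0 gt_eqF.
Qed.

(** On a probability space it suffices that [|f| <= 1 + |f|^p]. *)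
Lemma Lp_integrable_normc :
  mu.-integrable setT (EFin \o (fun w : borel G => normc (f w))).
Proof.
have i1 := integrable_addR measurableT (Rintegrable_const mu 1) Lp_integrable_powR.
apply: (le_integrable measurableT _ _ i1).
  by apply/measurable_EFinP; exact: Lp_measurable_normc.
move=> w _; rewrite lee_fin !ger0_norm ?normc_ge0//; last first.
  by rewrite addr_ge0// powR_ge0.
have [le1|lt1] := leP (normc (f w)) 1.
  by rewrite (le_trans le1)// lerDl powR_ge0.
by rewrite (le_trans (le1r_powR (ltW lt1) p1))// lerDr.
Qed.

Lemma Lp_cintegrable : cintegrable mu f.
Proof.
have [mr mi _] := fp.
split; apply: (le_integrable measurableT _ _ Lp_integrable_normc).
- exact/measurable_EFinP.
- by move=> w _; rewrite lee_fin (le_trans (abs_Re_le _)) ?ler_norm.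
- exact/measurable_EFinP.
- by move=> w _; rewrite lee_fin (le_trans (abs_Im_le _)) ?ler_norm.
Qed.

End Lp_function.

(* [|S_n| <= |f| * W] pointwise, uniformly in [n]; then Jensen's inequality.  As [W]
   is a trigonometric polynomial, no Fubini theorem on [G x G] is needed. *)
Lemma maximal_inequality_of_majorant (N : nat) (D : nat -> seq (R * R))
    (S : nat -> G -> R[i]) (W : seq (R * R)) (Wr : G -> R) p f :
  (forall w, trig beta W w = (Wr w)%:C) -> 0 < trig_mean beta W ->
  (forall n w, (n < N.+1)%N -> normc (trig beta (D n) w) <= Wr w) ->
  (forall n w, (n < N.+1)%N ->
    S n w = cintegral mu (fun v => f v * trig beta (D n) (w - v))) ->
  1 <= p -> Lp mu p%:E f ->
  ((\int[mu]_w ((\big[Num.max/0%R]_(n < N.+1) normc (S n w)) `^ p)%:E) `^ p^-1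
     <= (trig_mean beta W)%:E * cLnorm mu p%:E f)%E.
Proof.
move=> trigW V0 DW SE p1 fp.
have p0 : 0 < p by rewrite (lt_le_trans ltr01).
set V := trig_mean beta W.
have Wr0 w : 0 <= Wr w.
  exact: le_trans (normc_ge0 _) (DW 0%N w isT).
have fi := Lp_cintegrable p1 fp.
have ai := Lp_integrable_normc p1 fp.
have api := Lp_integrable_powR p1 fp.
pose U w := \int[mu]_v (normc (f v) * Wr (w - v)).
pose H w := \int[mu]_v (normc (f v) `^ p * Wr (w - v)).
pose I := \int[mu]_v (normc (f v) `^ p).
have U0 w : 0 <= U w by apply: Rintegral_ge0 => v _; rewrite mulr_ge0// normc_ge0.
have MU w : \big[Num.max/0]_(n < N.+1) normc (S n w) <= U w.
  apply: bigmax_le => // n _; rewrite SE//.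
  apply: normc_cintegral_le; first exact: cintegrable_conv_trig.
    exact: (Rintegrable_conv trigW w ai).
  by move=> v; rewrite normcM ler_wpM2l ?normc_ge0// DW.
have M0 w : 0 <= \big[Num.max/0]_(n < N.+1) normc (S n w).
  by rewrite -[leLHS]/(0 : R) bigmax_ge_id.
have UH w : U w `^ p <= V `^ (p - 1) * H w.
  exact: (conv_powR_le haar trigW Wr0 V0 w p1 (fun v => normc_ge0 (f v)) ai api).
have [Hi HI] : mu.-integrable setT (EFin \o (H : borel G -> R)) /\ \int[mu]_w H w = V * I.
  have ci := cintegrable_conv beta W (cintegrable_real api).
  (* [H] is the convolution of [|f|^p] with [W], so its integral is the product of the two means. *)
  have cI := cintegral_conv haar beta W (cintegrable_real api).
  have E : (fun w => cintegral mu (fun v => (normc (f v) `^ p)%:C * trig beta W (w - v)))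
      = (fun w => (H w)%:C).
    by apply/funext => w; rewrite (conv_real mu trigW).
  rewrite E in ci cI; split; first by have [] := ci.
  by apply: complexI; rewrite -cintegral_real cI cintegral_real -rmorphM.
have HiV := integrable_mulRl measurableT (V `^ (p - 1)) Hi.
have I0 : 0 <= I by apply: Rintegral_ge0 => v _; exact: powR_ge0.
have -> : cLnorm mu p%:E f = (I `^ p^-1)%:E.
  rewrite cLnormE -poweR_EFin /I /Rintegral fineK//.
  exact: integrable_fin_num api.
have le1 : (\int[mu]_w ((\big[Num.max/0%R]_(n < N.+1) normc (S n w)) `^ p)%:E <=
   (V `^ p * I)%:E)%E.
  apply: (@le_trans _ _ (\int[mu]_w (V `^ (p - 1) * H w)%:E)%E).
    apply: ge0_le_integral => //.
    - by move=> w _; rewrite lee_fin powR_ge0.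
    - apply/measurable_EFinP.
      apply: (measurableT_comp (measurable_powR p)).
      apply: (@measurable_bigmax _ (borel G) _ _ (fun n w => normc (S (nat_of_ord n) w))) => n.
      have -> : S n = (fun w => cintegral mu (fun v => f v * trig beta (D n) (w - v))).
        by apply/funext => w; rewrite SE.
      have [r i] := cintegrable_conv beta (D n) fi.
      apply: measurable_normc; apply/measurable_EFinP.
        by case/integrableP: r.
      by case/integrableP: i.
    - by case/integrableP: HiV.
    - move=> w _; rewrite lee_fin (le_trans _ (UH w))//.
      by apply: ge0_ler_powR; rewrite ?nnegrE// ltW.
  have /fineK <- := integrable_fin_num measurableT HiV.
  have -> : fine (\int[mu]_x (EFin \o (fun t => V `^ (p - 1) * H t)%R) x)%E =
    V `^ (p - 1) * (V * I).
    by rewrite -HI -RintegralZl.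
  by rewrite mulrA [_ * V]mulrC mulr_powRB1 ?(ltW V0).
apply: (@le_trans _ _ ((V `^ p * I)%:E `^ p^-1)%E).
  apply: gt0_ler_poweR; rewrite ?invr_ge0 ?(ltW p0)//.
  - by rewrite in_itv/= leey andbT integral_ge0// => w _; rewrite lee_fin powR_ge0.
  - by rewrite in_itv/= leey andbT lee_fin mulr_ge0 ?powR_ge0.
rewrite poweR_EFin -EFinM lee_fin powRM ?powR_ge0// -powRrM mulfV ?gt_eqF//.
by rewrite powRr1// ltW.
Qed.

End maximal_inequality.

(** * Kernels on a Dirichlet group *)

Section dirichlet_kernels.
Context {R : realType} {G : topologicalZmodType}.
Variable mu : probability (borel G) R.
Hypothesis haar : haar_probability mu.
Variables (lambda : R^nat) (beta : R -> G).
Hypotheses (lambdaF : frequency lambda) (betaD : dirichlet_group lambda beta).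

Local Notation h := (dirichlet_char beta).

Let dense_beta : dense (range beta).
Proof. by have [] := betaD. Qed.

Let has_char (x : R) := exists k, extends_exp beta x k.

Lemma lambda_inj : injective lambda.
Proof.
have [_ inc _] := lambdaF => i j ij.
by have [/inc|/inc|//] := ltngtP i j; rewrite ij ltxx.
Qed.

(** Products of characters realise sums of frequencies; this covers every element of the Folner
    set. *)
Lemma has_char_comb (I : Type) (s : seq I) (l : I -> nat) (n : I -> nat) :
  has_char (\sum_(i <- s) lambda (l i) *+ n i).
Proof.
elim/big_ind: _ => [|x y [k kx] [k' ky]|i _].
- by exists (fun=> 1); exact: extends_exp0.
- by exists (fun w => k w * k' w); exact: extends_expD.
have [_ _ _ /(_ (l i)) [k ki]] := betaD.
elim: (n i) => [|m [k' IH]].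
  by exists (fun=> 1); exact: extends_exp0.
by rewrite mulrS; exists (fun w => k w * k' w); exact: extends_expD.
Qed.

Lemma dirichlet_charB x y w : has_char x -> has_char y ->
  h (x - y) w = h x w * (h y w)^*.
Proof.
move=> /dirichlet_charP hx /dirichlet_charP hy.
by rewrite (dirichlet_char_eq dense_beta (extends_expB hx hy)).
Qed.

Lemma has_charB x y : has_char x -> has_char y -> has_char (x - y).
Proof. by move=> [k kx] [k' ky]; eexists; exact: extends_expB kx ky. Qed.

Lemma dirichlet_char_eq1 x : has_char x -> (h x == (fun=> 1)) = (x == 0).
Proof.
move=> /dirichlet_charP hx; apply/eqP/eqP => [E|->]; last first.
  exact: (dirichlet_char_eq dense_beta (extends_exp0 beta)).
by rewrite E in hx; exact: extends_exp_inj hx (extends_exp0 beta).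
Qed.

Variable A : seq R.
Hypotheses (uA : uniq A) (A_gt0 : (0 < size A)%N).
Hypothesis charA : forall x, x \in A -> has_char x.

Let iA : R := (size A)%:R^-1.

(** Once repeated frequencies are collected, the coefficient at [x] is [r x * diff_density A x].
    Keeping the pairs apart displays the polynomial as a quadratic form on [A]. *)
Definition diff_trig (r : R -> R) : seq (R * R) :=
  [seq (iA * r (x - y), x - y) | x <- A, y <- A].

Lemma big_diff_trig (M : nmodType) (r : R -> R) (F : R * R -> M) :
  \sum_(u <- diff_trig r) F u =
  \sum_(x <- A) \sum_(y <- A) F (iA * r (x - y), x - y).
Proof. by rewrite big_allpairs_dep. Qed.

Lemma trig_diff_trig r w : (forall x, r (- x) = r x) ->
  trig beta (diff_trig r) w =
  (iA * (quad_form r A (fun x => complex.Re (h x w)) +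
         quad_form r A (fun x => complex.Im (h x w))))%:C.
Proof.
move=> rN; rewrite /trig big_diff_trig.
pose a x := complex.Re (h x w); pose b x := complex.Im (h x w).
(* Up to the factor [iA], the imaginary part; for even [r] exchanging [x] and [y] changes its
   sign. *)
pose S := \sum_(x <- A) \sum_(y <- A) r (x - y) * (b x * a y - a x * b y).
have S0 : S = 0.
  have : S = - S.
    rewrite {1}/S exchange_big -sumrN; apply: eq_bigr => x _.
    rewrite -sumrN; apply: eq_bigr => y _.
    by rewrite -rN opprB; ring.
  by move/eqP; rewrite -addr_eq0 -mulr2n mulrn_eq0 => /eqP.
have -> : (iA * (quad_form r A a + quad_form r A b))%:C =
    (iA * (quad_form r A a + quad_form r A b)) +i* (iA * S) by rewrite S0 mulr0.
have E x y : x \in A -> y \in A ->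
    (iA * r (x - y))%:C * h (x - y) w =
    (iA * (r (x - y) * (a x * a y) + r (x - y) * (b x * b y))) +i*
    (iA * (r (x - y) * (b x * a y - a x * b y))).
  move=> xA yA; rewrite dirichlet_charB; [|exact: charA..].
  rewrite /a /b; case: (h x w) => a1 b1; case: (h y w) => a2 b2.
  by apply/eqP; rewrite eq_complex /=; apply/andP; split; apply/eqP; ring.
rewrite big_seq; under eq_bigr => x xA.
  rewrite big_seq; under eq_bigr => y yA do rewrite (E x y xA yA)//.
  over.
have sumC (I : eqType) (s : seq I) (P : pred I) (f g : I -> R) :
    \sum_(i <- s | P i) (f i +i* g i) =
    (\sum_(i <- s | P i) f i) +i* (\sum_(i <- s | P i) g i) :> R[i].
  elim/big_rec3: _ => //= i x y z _ ->; by apply/eqP; rewrite eq_complex/= !eqxx.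
under eq_bigr do rewrite sumC -!big_seq.
rewrite sumC -!big_seq /S /quad_form -big_split/= !mulr_sumr.
congr (_ +i* _); apply: eq_bigr => x _; last by rewrite mulr_sumr.
by rewrite -big_split/= mulr_sumr.
Qed.

(** Only the diagonal pairs give the trivial character, since [h_x] is trivial only for [x = 0]. *)
Lemma trig_mean_diff_trig r : trig_mean beta (diff_trig r) = r 0.
Proof.
rewrite /trig_mean big_diff_trig.
have E x : x \in A -> \sum_(y <- A) iA * r (x - y) * (h (x - y) == (fun=> 1))%:R = iA * r 0.
  move=> xA; rewrite (bigD1_seq x)//= subrr dirichlet_char_eq1; last first.
    by rewrite -(subrr x); apply: has_charB; exact: charA.
  rewrite eqxx mulr1 big_seq_cond big1 ?addr0// => y /andP[yA yx].
  rewrite dirichlet_char_eq1; last by apply: has_charB; exact: charA.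
  by rewrite subr_eq0 eq_sym (negPf yx) mulr0.
rewrite big_seq (eq_bigr _ (fun x xA => E x xA)) -big_seq.
rewrite big_const_seq count_predT iter_addr_0 -mulr_natr mulrAC mulVf ?mul1r//.
by rewrite pnatr_eq0 -lt0n.
Qed.

Lemma trig_cat s t w : trig beta (s ++ t) w = trig beta s w + trig beta t w.
Proof. by rewrite /trig big_cat. Qed.

Lemma trig_mean_cat s t : trig_mean beta (s ++ t) = trig_mean beta s + trig_mean beta t.
Proof. by rewrite /trig_mean big_cat. Qed.

Lemma normc_sum_le (I : Type) (s : seq I) (F : I -> R[i]) :
  normc (\sum_(i <- s) F i) <= \sum_(i <- s) normc (F i).
Proof.
elim: s => [|i s IH]; first by rewrite !big_nil normc0.
by rewrite !big_cons (le_trans (le_normcD _ _))// lerD2l.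
Qed.

Lemma normc_ofR (x : R) : normc x%:C = `|x|.
Proof. by rewrite /normc/= expr0n/= addr0 sqrtr_sqr. Qed.

Lemma normc_trig_le s w : normc (trig beta s w) <= \sum_(u <- s) `|u.1|.
Proof.
apply: le_trans (normc_sum_le _ _) _; apply: ler_sum => u _.
rewrite normcM normc_ofR.
by have [_ _ ->] := is_character_dirichlet_char beta u.2; rewrite mulr1.
Qed.

Local Notation kappa j := (diff_density A (lambda j)).

(* The Fourier coefficients of [f] select the frequencies [lambda_j] among the
   differences of elements of [A]. *)
Lemma sum_diff_trig f (r : R -> R) (m : nat) w :
  (forall chi, is_character chi ->
    (forall n, chi <> h (lambda n)) -> fourier mu f chi = 0) ->
  (forall j, (m <= j)%N -> r (lambda j) = 0) ->
  \sum_(u <- diff_trig r) u.1%:C * (fourier mu f (h u.2) * h u.2 w) =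
  \sum_(0 <= j < m) (r (lambda j) * kappa j)%:C *
     (fourier mu f (h (lambda j)) * h (lambda j) w).
Proof.
move=> specf r0; rewrite big_diff_trig /=.
pose a x := fourier mu f (h x) * h x w; rewrite -/(a _).
(* A difference equals at most one [lambda j]. If [j >= m] then [r] vanishes there; if there is no
   such [j], the character differs from all [h (lambda n)] and the Fourier coefficient of [f]
   vanishes. *)
have key x y : x \in A -> y \in A -> (r (x - y))%:C * a (x - y) =
    \sum_(0 <= j < m) (r (lambda j) * (x - y == lambda j)%:R)%:C * a (lambda j).
  move=> xA yA; have hxy := has_charB (charA xA) (charA yA).
  have [[j0 E]|none] := pselect (exists j, x - y = lambda j).
    rewrite E; have [j0m|mj0] := ltnP j0 m.
      rewrite (bigD1_seq j0) ?mem_index_iota ?iota_uniq//= eqxx mulr1.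
      rewrite big1 ?addr0// => j jj0; rewrite (inj_eq lambda_inj) eq_sym (negPf jj0).
      by rewrite mulr0 mul0r.
    rewrite r0// mul0r big_seq big1// => j; rewrite mem_index_iota => /andP[_ jm].
    rewrite (inj_eq lambda_inj) gtn_eqF ?mulr0 ?mul0r//.
    exact: leq_trans jm mj0.
  rewrite big1 => [|j _]; last first.
    have /eqP/negPf -> : x - y <> lambda j by move=> E; apply: none; exists j.
    by rewrite mulr0 mul0r.
  rewrite /a specf ?mul0r ?mulr0//; first exact: is_character_dirichlet_char.
  move=> n E; apply: none; exists n.
  have hxyP := dirichlet_charP hxy; rewrite E in hxyP.
  apply: extends_exp_inj hxyP _; apply: dirichlet_charP.
  by have [_ _ _] := betaD; apply.
transitivity (iA%:C * \sum_(x <- A) \sum_(y <- A)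
   \sum_(0 <= j < m) (r (lambda j) * (x - y == lambda j)%:R)%:C * a (lambda j)).
  rewrite mulr_sumr big_seq [RHS]big_seq; apply: eq_bigr => x xA.
  rewrite mulr_sumr big_seq [RHS]big_seq; apply: eq_bigr => y yA.
  by rewrite -key// [RHS]mulrA -rmorphM.
transitivity (iA%:C * \sum_(0 <= j < m) \sum_(x <- A) \sum_(y <- A)
   (r (lambda j) * (x - y == lambda j)%:R)%:C * a (lambda j)).
  congr (_ * _); rewrite [RHS]exchange_big/=; apply: eq_bigr => x _.
  by rewrite exchange_big.
rewrite mulr_sumr; apply: eq_bigr => j _; rewrite -/(a _).
transitivity (iA%:C * ((\sum_(x <- A) \sum_(y <- A)
   r (lambda j) * (x - y == lambda j)%:R)%:C * a (lambda j))).
  congr (_ * _); rewrite rmorph_sum mulr_suml; apply: eq_bigr => x _.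
  by rewrite rmorph_sum mulr_suml.
rewrite mulrA -rmorphM; congr (_%:C * _).
under eq_bigr do rewrite -mulr_sumr.
by rewrite -mulr_sumr /diff_density -/iA; ring.
Qed.

End dirichlet_kernels.

(** * Kernels reproducing the partial sums, with a common majorant *)

Section maximal_kernels.
Context {R : realType} {G : topologicalZmodType}.
Variable mu : probability (borel G) R.
Variables (lambda : R^nat) (beta : R -> G).
Hypotheses (lambdaF : frequency lambda) (betaD : dirichlet_group lambda beta).

Local Notation h := (dirichlet_char beta).

Let lambda_ge0 n : 0 <= lambda n.
Proof. by have [] := lambdaF. Qed.

Let lambda_lt m n : (m < n)%N -> lambda m < lambda n.
Proof. by have [_ /(_ m n)] := lambdaF. Qed.

Lemma lambda_le m n : (m <= n)%N -> lambda m <= lambda n.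
Proof. by rewrite leq_eqVlt => /predU1P[->//|/lambda_lt/ltW]. Qed.

Variables (N : nat) (A : seq R) (a b K : R).
Hypotheses (uA : uniq A) (A_gt0 : (0 < size A)%N).
Hypothesis charA : forall x, x \in A -> exists k, extends_exp beta x k.
Local Notation kappa j := (diff_density A (lambda j)).
Hypothesis folnerA : \sum_(j < N.+1) (1 - kappa j) <= 1.
Hypotheses (b_gt0 : 0 < b) (ba : 2 * b <= a).

Let V := cos_transform (majorant_kernel a b).

(* [K] pays for the frequencies on the slope of a trapezoid, [1] for the lack of
   exact invariance of [A]. *)
Definition majorant_trig : seq (R * R) := diff_trig A V ++ [:: (K + 1, 0)].

Definition majorant_value (w : G) : R :=
  (size A)%:R^-1 * (quad_form V A (fun x => complex.Re (h x w)) +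
                    quad_form V A (fun x => complex.Im (h x w))) + (K + 1).

Let dense_beta : dense (range beta).
Proof. by have [] := betaD. Qed.

Let h0 : h 0 = (fun=> 1).
Proof. exact: (dirichlet_char_eq dense_beta (extends_exp0 beta)). Qed.

Lemma trig_majorant w : trig beta majorant_trig w = (majorant_value w)%:C.
Proof.
rewrite /majorant_trig trig_cat (trig_diff_trig betaD charA); last exact: cos_transformN.
by rewrite /trig big_seq1/= h0 mulr1 -rmorphD.
Qed.

Lemma trig_mean_majorant : trig_mean beta majorant_trig = 8 / cos_gap_mass * ln (a / b) + K + 1.
Proof.
rewrite /majorant_trig trig_mean_cat (trig_mean_diff_trig betaD uA A_gt0 charA).
rewrite /V cos_transform_majorant0; last first.
  by have b0 := b_gt0; have ab := ba; apply/andP; split; lra.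
by rewrite /trig_mean big_seq1/= h0 eqxx mulr1 addrA.
Qed.

(** The trapezoid is [1] at the frequencies of index at most [n] and [0] from index [m] on. Only
    finitely many coefficients need correcting, and the cost of each correction is included in
    [majorant_value]. *)
Lemma dirichlet_kernel_exists n (mu1 : R) m : (n <= N)%N -> (n < m)%N ->
  lambda n < mu1 -> mu1 <= lambda m -> 2 * b <= mu1 - lambda n ->
  (lambda n + mu1) / 2 <= a -> (m - n)%:R <= K ->
  exists D : seq (R * R),
    (forall w, normc (trig beta D w) <= majorant_value w) /\
    forall f, cintegrable mu f ->
      (forall chi, is_character chi ->
        (forall n, chi <> h (lambda n)) -> fourier mu f chi = 0) ->
      forall w, partial_sum mu lambda beta n f w =
        cintegral mu (fun v => f v * trig beta D (w - v)).
Proof.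
move=> nN nm lamu mum bmu mua mnK.
have la0 := lambda_ge0 n.
pose T := trapezoid (lambda n) mu1.
have lamu' : 0 <= lambda n < mu1 by rewrite la0.
have T1 j : (j <= n)%N -> T (lambda j) = 1.
  by move=> jn; rewrite /T trapezoid_eq1// lambda_ge0 lambda_le.
have T0 j : (m <= j)%N -> T (lambda j) = 0.
  by move=> mj; rewrite /T trapezoid_eq0// (le_trans mum)// lambda_le.
have kap j : 0 <= kappa j <= 1 by exact: diff_density_itv.
(* The trapezoid spread over the differences of [A], minus the frequencies met on
   its slope, plus what is missing from the coefficients of index at most [n]. *)
exists (diff_trig A T ++
  [seq (- (T (lambda j) * kappa j), lambda j) | j <- index_iota n.+1 m] ++
  [seq (1 - kappa j, lambda j) | j <- index_iota 0 n.+1]); split.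
  move=> w; rewrite !trig_cat.
  apply: (le_trans (le_normcD _ _)); rewrite /majorant_value.
  (* The quadratic forms dominate the trapezoid part. Of the two corrections, the slope has fewer
     than [m - n] coefficients of modulus at most [1], and the completion is bounded by
     [folnerA]. *)
  apply: lerD.
    rewrite (trig_diff_trig betaD charA); last exact: trapezoidN.
    rewrite normc_ofR normrM ger0_norm ?invr_ge0// ler_wpM2l ?invr_ge0//.
    apply: (le_trans (ler_normD _ _)).
    by apply: lerD; apply: quad_form_trapezoid_le.
  apply: (le_trans (le_normcD _ _)); apply: lerD; apply: (le_trans (normc_trig_le _ _ _)).
    rewrite big_map; apply: le_trans mnK.
    apply: (@le_trans _ _ (\sum_(n.+1 <= j < m) 1)).
      apply: ler_sum => j _; rewrite normrN normrM.
      have /andP[t0 t1] := trapezoid_itv lamu' (lambda_ge0 j).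
      have /andP[k0 k1] := kap j.
      by rewrite !ger0_norm// -[leRHS]mulr1 ler_pM.
    rewrite big_const_nat iter_addr_0 ler_nat; lia.
  rewrite big_map; apply: le_trans folnerA.
  rewrite -(big_mkord xpredT (fun j => 1 - kappa j)).
  rewrite [leRHS](big_cat_nat _ (n := n.+1))//=.
  under eq_bigr => j _.
    rewrite ger0_norm; last by rewrite subr_ge0; case/andP: (kap j).
    over.
  by rewrite lerDl sumr_ge0// => j _; rewrite subr_ge0; case/andP: (kap j).
move=> f fi specf w; rewrite conv_trig//.
pose c x := fourier mu f (h x) * h x w.
set s3 := [seq (1 - kappa j, lambda j) | j <- index_iota 0 n.+1].
rewrite !big_cat/= big_map/= [X in _ + (_ + X)]big_map.
rewrite (sum_diff_trig lambdaF betaD charA w specf T0).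
rewrite (big_cat_nat _ (n := n.+1))//=.
(* [x2 + y] collects the indices strictly between [n] and [m], which cancel; [x1 + z] those up to
   [n], with coefficients [kappa j + (1 - kappa j) = 1]. *)
have comb (x1 x2 y z t : R[i]) : x2 + y = 0 -> x1 + z = t -> t = x1 + x2 + (y + z).
  by move=> e <-; rewrite (addrC y) addrACA e addr0.
apply: comb.
  rewrite -big_split big1// => j _.
  by rewrite /= -mulrDl -rmorphD subrr rmorph0 mul0r.
rewrite -big_split /partial_sum -(big_mkord xpredT (fun k => c (lambda k))).
rewrite big_nat [RHS]big_nat; apply: eq_bigr => j /andP[_ jn].
by rewrite /= T1// mul1r -mulrDl -rmorphD addrC subrK mul1r.
Qed.

End maximal_kernels.

(** * Choice of the parameters from (NC), and conclusion *)

Unset Implicit Arguments.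

Theorem theorem4p5 (R : realType) (lambda : R^nat)
    (G : topologicalZmodType) (mu : probability (borel G) R) (beta : R -> G) :
  frequency lambda -> condition_NC lambda ->
  compact [set: G] -> hausdorff_space G -> haar_probability mu ->
  dirichlet_group lambda beta ->
  forall delta : R, 0 < delta ->
  exists2 C : R, 0 < C &
  forall (N : nat) (p : R) (f : G -> R[i]),
    1 <= p -> Hp mu lambda beta p%:E f ->
    ((\int[mu]_w
        ((\big[Num.max/0%R]_(n < N.+1)
            normc (partial_sum mu lambda beta n f w)) `^ p)%:E) `^ p^-1
      <= (C * expR (delta * lambda N))%:E * cLnorm mu p%:E f)%E.
Proof.
move=> lF NC _ _ haar bD delta d0.
have [C0 C00 NCd] := NC delta d0.
have [l_ge0 l_lt _] := lF.
have l1_gt0 : 0 < lambda 1%N by rewrite (le_lt_trans (l_ge0 0%N))// l_lt.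
(* A positive lower bound for [lambda m + lambda n] whenever [n < m]: then [m >= 1], whereas
   [lambda 0] may vanish. *)
pose e := Num.min 1 (lambda 1%N).
have e_gt0 : 0 < e by rewrite lt_min ltr01.
have e_le1 : e <= 1 by rewrite ge_min lexx.
have e_lel : e <= lambda 1%N by rewrite ge_min lexx orbT.
pose L := ln (2 / e).
have L_ge0 : 0 <= L by apply: ln_ge0; rewrite ler_pdivlMr//; lra.
pose c := 8 / cos_gap_mass : R.
have c_gt0 : 0 < c by rewrite divr_gt0// cos_gap_mass_gt0.
have id_gt0 : 0 < delta^-1 by rewrite invr_gt0.
(* The mean of the majorant is [c * ln (a / b) + K + 1], with [K = C0 * E] and
   [ln (a / b) <= delta^-1 * E + K + L]; then [E >= 1] absorbs [L] and [1]. *)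
exists (c * (delta^-1 + C0 + L) + C0 + 1).
  have : 0 < c * (delta^-1 + C0 + L) by rewrite mulr_gt0//; lra.
  by lra.
move=> N p f p1 [fp specf].
set E := expR (delta * lambda N).
have E_ge : 1 + delta * lambda N <= E by exact: expR_ge1Dx.
have dl_ge0 : 0 <= delta * lambda N by rewrite mulr_ge0// ltW.
have E_ge1 : 1 <= E by lra.
pose K := C0 * E; have K_gt0 : 0 < K by rewrite mulr_gt0//; lra.
(* [a] bounds the midpoints of the slopes, whose length is at most [1]; [2 * b] bounds their lengths
   from below, uniformly in [n <= N]. *)
pose a := lambda N + 1; pose b := e / 2 * expR (- K).
have lN := l_ge0 N.
have eK_gt0 := expR_gt0 (- K).
have eK_le1 : expR (- K) <= 1 by rewrite -expR0 ler_expR; lra.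
have b_gt0 : 0 < b by rewrite mulr_gt0// divr_gt0.
have bE : 2 * b = e * expR (- K) by rewrite /b; field.
have b_le1 : 2 * b <= 1 by rewrite bE; nra.
have ba : 2 * b <= a by rewrite /a; lra.
have [A [uA A_gt0 combA folnerA]] := folner_set lambda N.
have charA x : x \in A -> exists k, extends_exp beta x k.
  by move=> /combA[n ->]; exact: (has_char_comb bD).
(* The condition on [n] stands under the existential so that [choice] gives a function on all of
   [nat], with the junk value [[::]] beyond [N]. *)
have kernels n : exists D, (n < N.+1)%N ->
    (forall w, normc (trig beta D w) <= majorant_value beta A a b K w) /\
    forall w, partial_sum mu lambda beta n f w =
      cintegral mu (fun v => f v * trig beta D (w - v)).
  have [nN|Nn] := leqP n N; last by exists [::]; rewrite ltnS leqNgt Nn.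
  have [m nm] := NCd n; set r := _ / _ => hm.
  have gap_gt0 : 0 < lambda m - lambda n by rewrite subr_gt0 l_lt.
  have ln0 := l_ge0 n.
  (* Both terms of (NC) are thus nonnegative, so each of them is at most [K]. *)
  have r_ge1 : 1 <= r by rewrite /r ler_pdivlMr//; lra.
  have lnr_ge0 := ln_ge0 r_ge1.
  have EnK : C0 * expR (delta * lambda n) <= K.
    by rewrite ler_pM2l// ler_expR ler_pM2l// (lambda_le lF).
  have mn_ge0 : 0 <= (m - n)%:R :> R by exact: ler0n.
  have l1m : lambda 1%N <= lambda m by apply: (lambda_le lF); exact: leq_ltn_trans nm.
  (* Exponentiating (NC) bounds the gap below by [(lambda m + lambda n) * expR (- K)]. *)
  have gapK : e * expR (- K) <= lambda m - lambda n.
    have : r <= expR K.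
      rewrite -[r]lnK ?posrE ?(lt_le_trans ltr01)// ler_expR; lra.
    rewrite /r ler_pdivrMr// => rK.
    rewrite expRN ler_pdivrMr ?expR_gt0//.
    by rewrite mulrC in rK; lra.
  pose mu1 := lambda n + Num.min 1 (lambda m - lambda n).
  have g_gt0 : 0 < Num.min 1 (lambda m - lambda n) by rewrite lt_min ltr01.
  have g_le1 : Num.min 1 (lambda m - lambda n) <= 1 by rewrite ge_min lexx.
  have g_le : Num.min 1 (lambda m - lambda n) <= lambda m - lambda n.
    by rewrite ge_min lexx orbT.
  have g_ge : 2 * b <= Num.min 1 (lambda m - lambda n).
    by rewrite le_min b_le1 bE.
  have lnN := lambda_le lF nN.
  have [D [DW DS]] := @dirichlet_kernel_exists R G mu lambda beta lF bD N A a b K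
    uA A_gt0 charA folnerA b_gt0 ba n mu1 m nN nm
    ltac:(rewrite /mu1; lra) ltac:(rewrite /mu1; lra) ltac:(rewrite /mu1; lra)
    ltac:(rewrite /mu1 /a; lra) ltac:(lra).
  exists D => _; split => // w.
  by apply: DS => //; exact: Lp_cintegrable fp.
have [D HD] := choice kernels.
have meanE := trig_mean_majorant bD K uA A_gt0 charA b_gt0 ba.
(* The three terms bound the logarithms of the factors [1 + lambda N], [expR K] and [2 / e]; the
   first uses [ln (1 + lambda N) <= lambda N] and [1 + delta * lambda N <= E]. *)
have lnab : ln (a / b) <= delta^-1 * E + K + L.
  have -> : a / b = (1 + lambda N) * ((2 / e) * expR K).
    by rewrite /a /b expRN; field; rewrite !gt_eqF ?expR_gt0.
  have e2 : 0 < 2 / e by rewrite divr_gt0.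
  have lN1 : 0 < 1 + lambda N by lra.
  have e2K : 0 < 2 / e * expR K by rewrite mulr_gt0// expR_gt0.
  rewrite lnM ?posrE// lnM ?posrE ?expR_gt0// expRK -/L.
  have lnl : ln (1 + lambda N) <= lambda N by apply: le_ln1Dx; lra.
  have : lambda N <= delta^-1 * E by rewrite mulrC ler_pdivlMr// mulrC; lra.
  by lra.
have mean_gt0 : 0 < trig_mean beta (majorant_trig A a b K).
  rewrite meanE -/c ltr_pwDr// addr_ge0 ?(ltW K_gt0)// mulr_ge0 ?(ltW c_gt0)//.
  by apply: ln_ge0; rewrite ler_pdivlMr// mul1r; lra.
have majE w : trig beta (majorant_trig A a b K) w = (majorant_value beta A a b K w)%:C.
  exact: (trig_majorant bD).
have H := @maximal_inequality_of_majorant R G mu haar beta N D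
  (fun n => partial_sum mu lambda beta n f) _ _ p f majE mean_gt0
  (fun n w nN => (HD n nN).1 w) (fun n w nN => (HD n nN).2 w) p1 fp.
apply: (le_trans H).
apply: lee_wpmul2r; first exact: Lnorm_ge0.
rewrite lee_fin meanE -/c -/E.
have : c * ln (a / b) <= c * (delta^-1 * E + K + L) by rewrite ler_pM2l.
have : c * L <= c * (L * E) by rewrite ler_pM2l// ler_peMr.
rewrite /K; lra.
Qed.
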